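(* Let $n\ge 2$ and let $M\in\mathrm{GL}(n,\mathbb{Z})$ have a characteristic polynomial $P(x)=\det(x\mathbf{1}-M)$ that is irreducible over $\mathbb{Z}$, and let $\lambda$ be a root of $P(x)$. Let $P(x)$ have $n_1$ real roots and $n_2$ pairs of complex conjugate (non-real) roots, so $n=n_1+2n_2$. Let $K=\mathbb{Q}(\lambda)$, let $\mathcal{O}_{\max}$ be its ring of integers, and let $E(K)=\mathcal{O}_{\max}^{\times}\simeq T\times\mathbb{Z}^{n_1+n_2-1}$ be its unit group, where $T$ is the finite cyclic group of roots of unity in $\mathcal{O}_{\max}$. Then the symmetry group $\mathcal{S}(M)=\{G\in\mathrm{GL}(n,\mathbb{Z}): MG=GM\}$ is isomorphic to a subgroup of $E(K)$ of maximal rank, i.e. $$\mathcal{S}(M)\;\simeq\; T'\times\mathbb{Z}^{n_1+n_2-1},$$ where $T'$ is a subgroup of $T$.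
   Context: $\mathrm{GL}(n,\mathbb{Z})$ is the group of integer $n\times n$ matrices with determinant $\pm1$. ''Maximal rank'' means that the rank as a finitely generated Abelian group equals that of $E(K)$. *)

(* Defs.v *)
From HB Require Import structures.
From mathcomp Require Import all_boot all_order all_algebra all_field.
From mathcomp Require Import classical_sets functions.

Set Implicit Arguments.
Unset Strict Implicit.
Unset Printing Implicit Defensive.

Import GRing.Theory Num.Theory.

Local Open Scope classical_set_scope.
Local Open Scope ring_scope.

(* Over int, unitmx means that the determinant is 1 or -1. *)
Record GLZ (n : nat) := MkGLZ { GLZval :> 'M[int]_n; _ : GLZval \in unitmx }.

HB.instance Definition _ n := [isSub for @GLZval n].
HB.instance Definition _ n := [Choice of GLZ n by <:].

Section GLZGroup.
Variable n : nat.
Implicit Types A B : GLZ n.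

Fact GLZ_one_subproof : (1%:M : 'M[int]_n) \in unitmx.
Proof. exact: unitmx1. Qed.

Fact GLZ_mul_subproof A B : (A : 'M[int]_n) *m B \in unitmx.
Proof. by rewrite unitmx_mul (valP A) (valP B). Qed.

Fact GLZ_inv_subproof A : invmx (A : 'M[int]_n) \in unitmx.
Proof. by rewrite unitmx_inv (valP A). Qed.

Definition GLZ_one := MkGLZ GLZ_one_subproof.
Definition GLZ_mul A B := MkGLZ (GLZ_mul_subproof A B).
Definition GLZ_inv A := MkGLZ (GLZ_inv_subproof A).

Fact GLZ_mulA : associative GLZ_mul.
Proof. by move=> A B C; apply: val_inj; apply: mulmxA. Qed.

Fact GLZ_mul1 : left_id GLZ_one GLZ_mul.
Proof. by move=> A; apply: val_inj; apply: mul1mx. Qed.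

Fact GLZ_mul1r : right_id GLZ_one GLZ_mul.
Proof. by move=> A; apply: val_inj; apply: mulmx1. Qed.

Fact GLZ_mulV : left_inverse GLZ_one GLZ_inv GLZ_mul.
Proof. by move=> A; apply: val_inj; apply: mulVmx; apply: (valP A). Qed.

Fact GLZ_mulVr : right_inverse GLZ_one GLZ_inv GLZ_mul.
Proof. by move=> A; apply: val_inj; apply: mulmxV; apply: (valP A). Qed.

HB.instance Definition _ := isGroup.Build (GLZ n)
  GLZ_mulA GLZ_mul1 GLZ_mul1r GLZ_mulV GLZ_mulVr.

End GLZGroup.

(* The multiplicative group of units of a ring; the library's {unit R} is
   restricted to finite rings. *)
Record units (R : unitRingType) :=
  MkUnits { unitsval :> R; _ : unitsval \is a GRing.unit }.

HB.instance Definition _ (R : unitRingType) := [isSub for @unitsval R].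
HB.instance Definition _ (R : unitRingType) := [Choice of units R by <:].

Section UnitsGroup.
Variable R : unitRingType.
Implicit Types u v : units R.

Fact units_mul_subproof u v : (u : R) * (v : R) \is a GRing.unit.
Proof. by rewrite unitrMr ?(valP u) ?(valP v). Qed.

Fact units_inv_subproof u : (u : R)^-1 \is a GRing.unit.
Proof. by rewrite unitrV (valP u). Qed.

Definition units_one := MkUnits (unitr1 R).
Definition units_mul u v := MkUnits (units_mul_subproof u v).
Definition units_inv u := MkUnits (units_inv_subproof u).

Fact units_mulA : associative units_mul.
Proof. by move=> u v w; apply: val_inj; apply: mulrA. Qed.

Fact units_mul1 : left_id units_one units_mul.
Proof. by move=> u; apply: val_inj; apply: mul1r. Qed.

Fact units_mul1r : right_id units_one units_mul.
Proof. by move=> u; apply: val_inj; apply: mulr1. Qed.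

Fact units_mulV : left_inverse units_one units_inv units_mul.
Proof. by move=> u; apply: val_inj; apply: mulVr; apply: (valP u). Qed.

Fact units_mulVr : right_inverse units_one units_inv units_mul.
Proof. by move=> u; apply: val_inj; apply: mulrV; apply: (valP u). Qed.

HB.instance Definition _ := isGroup.Build (units R)
  units_mulA units_mul1 units_mul1r units_mulV units_mulVr.

End UnitsGroup.

Definition is_subgroup (G : groupType) (A : set G) :=
  A 1%g /\ (forall x y, A x -> A y -> A (x / y)%g).

Definition isomorphic (G H : groupType) (A : set G) (B : set H) :=
  exists2 f : G -> H,
    set_bij A B f & forall x y, A x -> A y -> f (x * y)%g = (f x * f y)%g.

Definition expgz (G : groupType) (x : G) (z : int) : G :=
  match z with Posz k => (x ^+ k)%g | Negz k => (x ^- k.+1)%g end.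

(* The next three notions are meant for commutative subgroups A, for which
   the order of the factors of the products is irrelevant. *)
Definition finitely_generated (G : groupType) (A : set G) :=
  exists k (e : 'I_k -> G), (forall i, A (e i)) /\
    forall x, A x -> exists c : 'I_k -> int, x = (\prod_i expgz (e i) (c i))%g.

Definition independent (G : groupType) k (e : 'I_k -> G) :=
  forall c : 'I_k -> int,
    (\prod_i expgz (e i) (c i))%g = 1%g -> forall i, c i = 0.

Definition has_rank (G : groupType) (A : set G) (r : nat) :=
  [/\ finitely_generated A,
      exists2 e : 'I_r -> G, (forall i, A (e i)) & independent e
    & forall e : 'I_r.+1 -> G, (forall i, A (e i)) -> ~ independent e].

Definition maximal_rank (G : groupType) (A B : set G) :=
  exists2 r, has_rank A r & has_rank B r.

(* Irreducibility in the ring R itself. For R = {poly int}, the library's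
   irreducible_poly is based on pseudo-division, hence expresses
   irreducibility over the rationals. *)
Definition irreducible_in (R : idomainType) (p : R) :=
  [/\ p != 0, p \isn't a GRing.unit
    & forall q r : R, p = q * r -> q \is a GRing.unit \/ r \is a GRing.unit].

(* p has n1 real roots rs and n2 pairs (z, z^* ), z in cs, of non-real roots,
   counted with multiplicity. *)
Definition has_signature (p : {poly int}) (n1 n2 : nat) :=
  exists rs cs : seq algC,
    [/\ size rs = n1, size cs = n2,
        {in rs, forall z, z \is Num.real}, {in cs, forall z, z \isn't Num.real}
      & map_poly intr p = (lead_coef p)%:~R *:
          \prod_(z <- rs ++ cs ++ [seq z^* | z <- cs]) ('X - z%:P)].

Definition integers (K : fieldExtType rat) : set K :=
  [set x | integralOver (intr : int -> K) x].
Arguments integers K : clear implicits.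

Definition unit_group (K : fieldExtType rat) : set (units K) :=
  [set u : units K | integers K (unitsval u) /\ integers K (unitsval u)^-1].
Arguments unit_group K : clear implicits.

Definition roots_of_unity (K : fieldExtType rat) : set (units K) :=
  [set u : units K | integers K (unitsval u) /\
    exists2 k, (0 < k)%N & (u ^+ k)%g = 1%g].
Arguments roots_of_unity K : clear implicits.

Definition symmetry_group n (M : GLZ n) : set (GLZ n) :=
  [set G : GLZ n | (M * G)%g = (G * M)%g].

(* Main.v *)
Require Import Defs.
From HB Require Import structures.
From mathcomp Require Import all_boot all_order all_algebra all_field.
From mathcomp Require Import classical_sets functions.
From mathcomp Require Import boolp cardinality ring zify.

(* Let v be an eigenvector of M over K = Q(lambda).  A matrix G that commutes
   with M satisfies v G = phi(G) v, and phi identifies the integral commutant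
   of M with an order of K, hence S(M) with the unit group of that order.  What
   remains is Dirichlet's unit theorem, both for this order and for the maximal
   one.

   The proof of the latter avoids logarithms and works with the absolute values
   |x|_p at the places p themselves.  Thue's pigeonhole argument in Z[M] yields
   for each place p a unit u_p in S(M) with |u_p|_q < 1 for all q <> p.  Units of
   this shape, one place p0 being omitted, are independent: a relation would
   equate two products whose common value is at most 1 at all places and less
   than 1 at p0, against the product formula.  Conversely, a unit x with
   |x|_p >= 1 for all p <> p0 can be divided by some u_p, p <> p0, as long as it
   is large at p; this increases |x|_p0 <= 1, so that finiteness of bounded
   sets of algebraic integers makes it stop at an element of a fixed finite
   set.  Hence the u_p, p <> p0, generate a subgroup of finite index in both
   unit groups. *)

Set Implicit Arguments.
Unset Strict Implicit.
Unset Printing Implicit Defensive.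

Import Order.TTheory GRing.Theory Num.Theory.
Local Open Scope ring_scope.

(** * Multiplicative groups modulo torsion *)

(** Exponents form an integer row vector, so that a change of generators amounts to multiplication
    by an integer matrix. *)
Definition monomial (K : fieldType) k (g : 'I_k -> K) (c : 'rV[int]_k) : K :=
  \prod_i g i ^ c 0 i.

Section Monomials.
Variables (K : fieldType) (k : nat) (g : 'I_k -> K).
Hypothesis g_neq0 : forall i, g i != 0.

Lemma monomial_neq0 c : monomial g c != 0.
Proof. by apply/prodf_neq0 => i _; apply: expfz_neq0. Qed.

Lemma monomial0 : monomial g 0 = 1.
Proof. by rewrite /monomial big1 // => i _; rewrite mxE expr0z. Qed.

Lemma monomialD c d : monomial g (c + d) = monomial g c * monomial g d.
Proof.
by rewrite /monomial -big_split; apply: eq_bigr => i _; rewrite mxE expfzDr.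
Qed.

Lemma monomialN c : monomial g (- c) = (monomial g c)^-1.
Proof.
apply: (mulfI (monomial_neq0 c)).
by rewrite -monomialD subrr monomial0 divff ?monomial_neq0.
Qed.

Lemma monomialZ z c : monomial g (z *: c) = monomial g c ^ z.
Proof.
rewrite /monomial (big_morph (fun x => x ^ z) (fun x y => expfzMl x y z) (exp1rz _ z)).
by apply: eq_bigr => i _; rewrite mxE mulrC exprz_exp.
Qed.

Lemma monomial_delta i : monomial g (delta_mx 0 i) = g i.
Proof.
rewrite /monomial (bigD1 i) //= mxE !eqxx expr1z big1 ?mulr1 // => j ji.
by rewrite mxE (negPf ji) andbF expr0z.
Qed.

Lemma monomial_mulmx l (A : 'M_(l, k)) c :
  monomial (fun j => monomial g (row j A)) c = monomial g (c *m A).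
Proof.
rewrite mulmx_sum_row.
rewrite (big_morph (monomial g) monomialD monomial0).
by apply: eq_bigr => j _; rewrite monomialZ.
Qed.

End Monomials.

Lemma int_mulmx_eq0 m (d : 'rV[int]_m) (S : 'M_m) : \det S != 0 -> d *m S = 0 -> d = 0.
Proof.
move=> S0 dS; have : d *m S *m \adj S = 0 by rewrite dS mul0mx.
rewrite -mulmxA mul_mx_adj mul_mx_scalar => /eqP.
by rewrite scalemx_eq0 (negPf S0) => /eqP.
Qed.

(* The exponent vectors of the N-th powers of U form a lattice of full rank in
   Z^r; its Smith normal form provides a basis of U modulo torsion. *)
Lemma basis_mod_torsion (K : fieldType) k r (g : 'I_k -> K) (v : 'I_r -> K)
    (N : nat) (A : 'M_(k, r)) (B : 'M_(r, k)) :
    (forall i, g i != 0) -> (0 < N)%N ->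
    (forall c, monomial v c = 1 -> c = 0) ->
    (forall i, g i ^+ N = monomial v (row i A)) ->
    (forall j, v j = monomial g (row j B)) ->
  exists E : 'M_(r, k), let e j := monomial g (row j E) in
    (forall c, exists d, (monomial g c / monomial e d) ^+ N = 1) /\
    (forall d m, (0 < m)%N -> monomial e d ^+ m = 1 -> d = 0).
Proof.
move=> g0 N0 vfree gA vB.
have v0 j : v j != 0 by rewrite vB monomial_neq0.
have gN c : monomial g c ^+ N = monomial v (c *m A).
  rewrite -monomial_mulmx // exprnP -monomialZ //.
  by apply: eq_bigr => i _; rewrite -gA exprnP exprz_exp [in LHS]mxE.
(* The rows of both sides are exponent vectors of [v j ^+ N], and the independence of [v] makes
   these unique. *)
have NBA : B *m A = N%:Z%:M.
  apply/row_matrixP => j; apply/eqP; rewrite -subr_eq0; apply/eqP/vfree.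
  have -> : row j N%:Z%:M = N%:Z *: delta_mx 0 j.
    by rewrite -scalemx1 linearZ /= row1.
  rewrite monomialD // monomialN // row_mul -gN -vB monomialZ // monomial_delta.
  by rewrite -exprnP divff // expf_neq0.
have [L Lu [R Ru [d _ dA]]] := int_Smith_normal_form A.
set D := (X in L *m X *m R) in dA.
(* [J] selects the first [r] rows; the rows of [D] beyond them vanish, so that [S] retains all of
   [D]. *)
pose J : 'M[int]_(r, k) := \matrix_(j, i) (i == j :> nat)%:R.
have [S JDS JD] : exists2 S, J *m D = S & D = J^T *m S.
  exists (J *m D) => //.
  apply/matrixP => i j; rewrite mulmxA !mxE (bigD1 i) //= big1 => [|l li].
    rewrite addr0 !mxE; have [ij|nij] := eqVneq (i : nat) (j : nat); last by rewrite mulr0n mulr0.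
    rewrite (bigD1 j) //= big1 => [|l lj]; first by rewrite !mxE ij eqxx addr0 !mul1r.
    rewrite !mxE ij (_ : (j == l :> nat) = false) ?mul0r //.
    by apply/negbTE; rewrite eq_sym.
  rewrite mxE big1 ?mul0r // => m _; rewrite !mxE.
  have [im|_] := eqVneq (i : nat) (m : nat); last by rewrite mul0r.
  rewrite -im (_ : (l == i :> nat) = false) ?mulr0 //.
  by apply/negbTE.
(* [\det S] divides the determinant of [B *m A], which is a power of [N]. *)
have S0 : \det S != 0.
  apply/eqP => S0.
  have : \det (B *m A) = 0.
    by rewrite dA JD !mulmxA -(mulmxA _ S) !det_mulmx ?S0 ?mul0r ?mulr0.
  by rewrite NBA det_scalar => /eqP; rewrite expf_eq0 -[N%:Z == 0]/(N == 0%N) eqn0Ngt N0 andbF.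
(* The rows of [invmx L] give new generators: the [N]-th powers of the first [r] have exponent
   matrix [S *m R], those of the others are 1. Truncating [c *m L], the new coordinates of [c], thus
   costs only torsion. *)
pose E := J *m invmx L; exists E => e.
have EA : E *m A = S *m R.
  by rewrite /E dA !mulmxA -(mulmxA J) mulVmx // mulmx1 JDS.
split.
  move=> c; exists (c *m L *m J^T).
  rewrite /e monomial_mulmx // -monomialN // -monomialD // gN mulmxBl.
  rewrite -[X in _ - X]mulmxA EA {1}dA JD !mulmxA subrr.
  exact: monomial0.
move=> c m m0 cm; apply: (int_mulmx_eq0 S0).
suff /vfree : monomial v (m%:Z *: (c *m S *m R)) = 1.
  move=> /eqP; rewrite scalemx_eq0 => /orP[/eqP/(congr1 absz)/= m00|/eqP].
    by rewrite m00 in m0.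
  by move/(congr1 (mulmx^~ (invmx R))); rewrite /= mul0mx -[_ *m R *m _]mulmxA mulmxV // mulmx1.
rewrite monomialZ // -mulmxA -EA mulmxA -gN -monomial_mulmx //.
by rewrite -exprnP exprAC cm expr1n.
Qed.

(** * Units from absolute values *)

Lemma infinite_pigeonhole (T : eqType) (s : seq T) (f : nat -> T) :
  (forall k, f k \in s) -> exists k l, (k < l)%N /\ f k = f l.
Proof.
move=> fs.
have /uniqPn : ~~ uniq (map f (iota 0 (size s).+1)).
  apply/negP => un; have := @uniq_leq_size _ _ s un.
  by rewrite size_map size_iota ltnn => /(_ _)/notF; apply=> _ /mapP[k _ ->].
move=> /(_ (f 0%N))[k [l [kl]]]; rewrite size_map size_iota => ls.
have ks := ltn_trans kl ls.
by rewrite !(nth_map 0%N) ?size_iota // !nth_iota // !add0n; exists k, l.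
Qed.

(** The order may be partial, as on [algC]; hence maximality is phrased as the absence of a strictly
    larger value. *)
Lemma seq_maximal (R : numDomainType) (T : eqType) (f : T -> R) (s : seq T) x :
  x \in s -> exists2 y, y \in s & forall z, z \in s -> ~~ (f y < f z).
Proof.
elim: s x => // a s IH x _; case: s IH => [_|b s IH].
  by exists a; rewrite ?mem_head // => z; rewrite inE => /eqP->; rewrite ltxx.
have [y ys ymax] := IH b (mem_head _ _).
have [ya|ya] := boolP (f y < f a); last first.
  exists y; first by rewrite inE ys orbT.
  by move=> z; rewrite inE => /predU1P[->|/ymax].
exists a; first exact: mem_head.
move=> z; rewrite inE => /predU1P[->|/ymax]; first by rewrite ltxx.
by apply: contra => /(lt_trans ya).
Qed.

(** By Bernoulli's inequality the powers of [t^-1] grow at least linearly, and the order is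
    archimedean. *)
Lemma exists_expr_le (t y : algC) : 0 <= t -> t < 1 -> 0 < y ->
  exists l, forall m, (l <= m)%N -> t ^+ m <= y.
Proof.
move=> t0 t1 y0.
have bern h n : 0 <= h -> n%:R * h <= (1 + h) ^+ n :> algC.
  move=> h0; elim: n => [|n IH]; first by rewrite mul0r expr0 ler01.
  have h1 : 1 <= (1 + h) ^+ n by rewrite exprn_ege1 // lerDl.
  by rewrite exprS mulrDl mul1r -natr1 mulrDl mul1r lerD // ler_peMr.
have [->|tn0] := eqVneq t 0.
  by exists 1%N => m m1; rewrite expr0n gtn_eqF // ltW.
have tp : 0 < t by rewrite lt_def tn0.
pose h := t^-1 - 1.
have h0 : 0 < h by rewrite subr_gt0 invf_gt1.
pose l := Num.bound (y^-1 / h); exists l => m lm.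
have lP : y^-1 / h < l%:R by apply: archi_boundP; rewrite divr_ge0 ?invr_ge0 ?ltW.
rewrite -[t]invrK exprVn -[y]invrK lef_pV2 ?posrE ?exprn_gt0 ?invr_gt0 //.
rewrite -[t^-1](subrK 1) addrC.
apply: le_trans (bern _ _ (ltW h0)); rewrite -ler_pdivrMr //.
by apply: le_trans (ltW lP) _; rewrite ler_nat.
Qed.

(** * Dirichlet's unit theorem for a group with given absolute values *)

Section AbstractUnits.
(** The [sigma p] represent the places and [w p] is the local degree, so that [U_prod] is the
    product formula; [ord0] is the place to be omitted. *)
Variables (K : fieldType) (r : nat) (sigma : 'I_r.+1 -> {rmorphism K -> algC}).
Variables (w : 'I_r.+1 -> nat) (U : set K) (u : 'I_r.+1 -> K).
Hypothesis w_gt0 : forall p, (0 < w p)%N.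
Hypothesis U1 : U 1.
Hypothesis Udiv : forall x y, U x -> U y -> U (x / y).
Hypothesis U_neq0 : forall x, U x -> x != 0.
Hypothesis U_prod : forall x, U x -> \prod_p `|sigma p x| ^+ w p = 1.
Hypothesis U_bounded_finite : forall B : algC,
  finite_set [set x | U x /\ forall p, `|sigma p x| <= B].
Hypothesis Uu : forall p, U (u p).
Hypothesis u_lt1 : forall p q, q != p -> `|sigma q (u p)| < 1.

Lemma U_inv x : U x -> U x^-1.
Proof. by move=> Ux; rewrite -div1r; apply: Udiv. Qed.

Lemma U_mul x y : U x -> U y -> U (x * y).
Proof. by move=> Ux Uy; rewrite -[y]invrK; apply: Udiv => //; apply: U_inv. Qed.

Lemma U_exp x n : U x -> U (x ^+ n).
Proof. by move=> Ux; elim: n => [|n IH]; rewrite ?expr0 // exprS; apply: U_mul. Qed.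

Lemma U_expz x z : U x -> U (x ^ z).
Proof. by move=> Ux; case: z => n; [apply: U_exp | apply/U_inv/U_exp]. Qed.

Lemma U_monomial k (g : 'I_k -> K) c : (forall i, U (g i)) -> U (monomial g c).
Proof.
move=> Ug; rewrite /monomial; elim/big_ind: _ => // [x y|i _]; first exact: U_mul.
exact: U_expz.
Qed.

Let v (j : 'I_r) := u (lift ord0 j).

Lemma v_in_U j : U (v j). Proof. exact: Uu. Qed.

Lemma v_neq0 j : v j != 0. Proof. exact/U_neq0/v_in_U. Qed.

Lemma place_gt0 p x : U x -> 0 < `|sigma p x|.
Proof. by move=> /U_neq0 x0; rewrite normr_gt0 fmorph_eq0. Qed.

Lemma U_not_all_le1 x q : U x -> (forall p, `|sigma p x| <= 1) ->
  ~~ (`|sigma q x| < 1).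
Proof.
move=> Ux le1; apply/negP => lt1; have := U_prod Ux.
rewrite (bigD1 q) //=; apply/eqP; rewrite lt_eqF //.
have le1w : \prod_(p | p != q) `|sigma p x| ^+ w p <= 1.
  by apply: prodr_ile1 => p _; rewrite exprn_ge0 // exprn_ile1.
apply: le_lt_trans (ler_piMr _ le1w) _; first exact: exprn_ge0.
by rewrite exprn_ilt1 // -lt0n.
Qed.

Lemma v_independent c : monomial v c = 1 -> c = 0.
Proof.
(* Applied to a relation and to its inverse, this forces all exponents to vanish. *)
have npos (d : 'rV[int]_r) : monomial v d = 1 -> forall i, ~~ (0 < d 0 i).
  move=> d1 i0; apply/negP => di0.
  pose N (i : 'I_r) := absz (d 0 i).
  pose x := \prod_(i | 0 < d 0 i) v i ^+ N i.
  pose y := \prod_(i | ~~ (0 < d 0 i)) v i ^+ N i.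
  (* This is the relation with its nonpositive exponents moved to the other side. *)
  have xy : x = y.
    have y0 : y != 0 by apply/prodf_neq0 => i _; rewrite expf_neq0 ?v_neq0.
    apply: (mulIf (invr_neq0 y0)); rewrite divff // -[RHS]d1.
    rewrite /monomial (bigID (fun i => 0 < d 0 i)) /= /y -prodfV.
    congr (_ * _); apply: eq_bigr => i di; rewrite /N; first by rewrite exprnP gtz0_abs.
    by rewrite -exprVn exprnP exprz_inv lez0_abs ?opprK // leNgt.
  have Ux : U x.
    by rewrite /x; elim/big_ind: _ => // [a b|i _]; [apply: U_mul | apply/U_exp/v_in_U].
  have le1 (q : 'I_r.+1) (Q : pred 'I_r) : (forall i, Q i -> q != lift ord0 i) ->
      `|sigma q (\prod_(i | Q i) v i ^+ N i)| <= 1.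
    move=> qQ; rewrite rmorph_prod normr_prod; apply: prodr_ile1 => i Qi.
    by rewrite normr_ge0 rmorphXn normrX exprn_ile1 // ltW // u_lt1 ?qQ.
  (* At the place of [v j], one of the expressions [x] and [y] does not contain [v j], and all its
     factors are less than 1 there. *)
  have le1x q : `|sigma q x| <= 1.
    case: (unliftP ord0 q) => [j ->|->]; last by apply: le1 => i _.
    have [dj|dj] := boolP (0 < d 0 j); last first.
      by apply: le1 => i di; apply: contraNneq dj => /lift_inj->.
    by rewrite xy; apply: le1 => i di; apply: contraNneq di => /lift_inj<-.
  have /negP[] := U_not_all_le1 ord0 Ux le1x.
  rewrite /x (bigD1 i0) //= rmorphM normrM.
  have le2 : `|sigma ord0 (\prod_(i | (0 < d 0 i) && (i != i0)) v i ^+ N i)| <= 1.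
    by apply: le1.
  apply: le_lt_trans (ler_piMr _ le2) _ => //.
  rewrite rmorphXn normrX exprn_ilt1 // ?u_lt1 //.
  by rewrite absz_eq0 gt_eqF.
move=> c1; apply/rowP => i; rewrite mxE.
have := npos _ c1 i; have := npos (- c) _ i.
rewrite monomialN ?c1 ?invr1 ?mxE ?oppr_gt0; last exact: v_neq0.
by move=> /(_ erefl); rewrite -!leNgt => ? ?; apply/eqP; rewrite eq_le; apply/andP.
Qed.

(** Where [x] exceeds [D], dividing by [u p] leaves a value of at least 1; the summand 1 makes [D] a
    bound at [ord0] too. *)
Let D : algC := 1 + \sum_p `|sigma p (u p)|.

Lemma D_ge1 : 1 <= D.
Proof. by rewrite lerDl sumr_ge0. Qed.

Lemma D_geu p : `|sigma p (u p)| <= D.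
Proof.
rewrite /D (bigD1 p) //= addrCA lerDl addr_ge0 ?ler01 //.
by rewrite sumr_ge0.
Qed.

(* Dividing by [u p], for a place [p <> ord0] at which [x] is larger than [D],
   preserves the hypothesis and enlarges [x] at [ord0]; by finiteness this
   cannot be repeated forever. *)
Lemma bounded_representative x : U x ->
    (forall p, p != ord0 -> 1 <= `|sigma p x|) ->
  exists c, forall p, `|sigma p (x * monomial v c)| <= D.
Proof.
move=> Ux x1.
pose S := [set y | U y /\ [/\ exists c, y = x * monomial v c,
  forall p, p != ord0 -> 1 <= `|sigma p y| & `|sigma ord0 x| <= `|sigma ord0 y|]]%classic.
have prod0 y : U y ->
    \prod_(p | p != ord0) `|sigma p y| ^+ w p = (`|sigma ord0 y| ^+ w ord0)^-1.
  move=> Uy; have := U_prod Uy; rewrite (bigD1 ord0) //= => e.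
  apply: (mulfI (_ : `|sigma ord0 y| ^+ w ord0 != 0)).
    by rewrite expf_neq0 // gt_eqF // place_gt0.
  by rewrite e divff // expf_neq0 // gt_eqF // place_gt0.
have le0 y : U y -> (forall p, p != ord0 -> 1 <= `|sigma p y|) -> `|sigma ord0 y| <= 1.
  move=> Uy y1; have : 1 <= (`|sigma ord0 y| ^+ w ord0)^-1.
    rewrite -prod0 // -[leLHS](@big1_eq _ _ *%R _ (index_enum 'I_r.+1) (fun p => p != ord0)).
    by apply: ler_prod => p p0; rewrite ler01 exprn_ege1 // y1.
  rewrite invf_ge1 ?exprn_gt0 ?place_gt0 // => h.
  have := @real_leP _ `|sigma ord0 y| 1 (normr_real _) (real1 _); case=> // h1.
  by have := exprn_egt1 (w ord0) h1; rewrite -lt0n w_gt0 => /lt_le_trans/(_ h); rewrite ltxx.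
(* At [p != ord0] the value of [y] is at most the weighted product over all places but [ord0], which
   is the inverse of the weighted value at [ord0]; the latter is at least that of [x]. *)
pose B := 1 + (`|sigma ord0 x| ^+ w ord0)^-1.
have Sfin : finite_set S.
  apply: sub_finite_set (U_bounded_finite B) => y [Uy [_ y1 yx]]; split=> // p.
  have B0 : 0 <= (`|sigma ord0 x| ^+ w ord0)^-1 by rewrite invr_ge0 exprn_ge0.
  have [->|p0] := eqVneq p ord0; first by apply: le_trans (le0 y Uy y1) _; rewrite lerDl.
  apply: le_trans (_ : (`|sigma ord0 x| ^+ w ord0)^-1 <= _); last by rewrite lerDr.
  apply: le_trans (_ : (`|sigma ord0 y| ^+ w ord0)^-1 <= _); last first.
    rewrite lef_pV2 ?posrE ?exprn_gt0 ?place_gt0 //.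
    by rewrite lerXn2r ?nnegrE.
  rewrite -prod0 // (bigD1 p) //=.
  apply: le_trans (ler_eXnr (w_gt0 p) (y1 p p0)) _.
  rewrite ler_peMr ?exprn_ge0 //.
  rewrite -[leLHS](@big1_eq _ _ *%R _ (index_enum 'I_r.+1) (fun q => (q != ord0) && (q != p))).
  by apply: ler_prod => q /andP[q0 _]; rewrite ler01 exprn_ege1 // y1.
have /finite_seqP[s sS] := Sfin.
have Sx : S x by split=> //; split=> //; exists 0; rewrite monomial0 mulr1.
have xs : x \in s by move: Sx; rewrite sS.
(* An element of [S] maximal at [ord0] admits no further division step, so it must be bounded by
   [D]. *)
have [y ys ymax] := seq_maximal (fun y => `|sigma ord0 y|) xs.
have [Uy [[c yc] y1 yx]] : S y by rewrite sS.
exists c => p; rewrite -yc.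
have [->|p0] := eqVneq p ord0; first exact: le_trans (le0 y Uy y1) D_ge1.
have Dr : D \is Num.real by rewrite ger0_real // (le_trans ler01 D_ge1).
have := @real_leP _ `|sigma p y| D (normr_real _) Dr; case=> // Dy.
pose z := y / u p.
have zlt q : q != p -> `|sigma q y| < `|sigma q z|.
  move=> qp; rewrite rmorphM fmorphV normrM normfV ltr_pMr ?place_gt0 //.
  by rewrite invf_gt1 ?place_gt0 ?u_lt1.
have /ymax/negP[] : z \in s; last by apply: zlt; rewrite eq_sym.
suff: S z by rewrite sS.
split; first exact: Udiv.
split; last first.
- by apply: le_trans yx (ltW (zlt _ _)); rewrite eq_sym.
- move=> q q0; have [->|qp] := eqVneq q p; last exact: le_trans (y1 q q0) (ltW (zlt q qp)).
  rewrite rmorphM fmorphV normrM normfV ler_pdivlMr ?place_gt0 // mul1r.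
  by apply: le_trans (D_geu p) (ltW Dy).
case: (unliftP ord0 p) p0 @z zlt {Dy} => [j ->|->] // _ z _.
exists (c - delta_mx 0 j).
rewrite monomialD ?monomialN ?monomial_delta; try exact: v_neq0.
by rewrite mulrA -yc.
Qed.

(** Since [u ord0] is less than 1 at all other places, dividing by a high power of it makes [x] at
    least 1 there, as [bounded_representative] requires. *)
Lemma U_decomposition x : U x ->
  exists l c, forall p, `|sigma p (x * (u ord0)^-1 ^+ l * monomial v c)| <= D.
Proof.
move=> Ux.
have /fin_all_exists[l lP] (p : 'I_r.+1) : exists l, p != ord0 ->
    forall m, (l <= m)%N -> `|sigma p (u ord0)| ^+ m <= `|sigma p x|.
  have [->|p0] := eqVneq p ord0; first by exists 0%N.
  have [l lP] := exists_expr_le (normr_ge0 _) (u_lt1 p0) (place_gt0 p Ux).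
  by exists l.
pose L := \max_p l p; exists L; apply: bounded_representative.
  by apply: U_mul => //; apply/U_exp/U_inv.
move=> p p0; rewrite rmorphM rmorphXn fmorphV normrM normrX normfV exprVn.
rewrite ler_pdivlMr ?exprn_gt0 ?place_gt0 // mul1r lP //.
exact: leq_bigmax.
Qed.

Lemma bounded_seq : exists s : seq K, forall x, x \in s <-> (U x /\ forall p, `|sigma p x| <= D).
Proof.
have /finite_seqP[s sE] := U_bounded_finite D; exists s => x.
split=> [xs|]; first by have : [set` s]%classic x by []; rewrite -sE.
by rewrite -[_ /\ _]/([set x | U x /\ forall p, `|sigma p x| <= D]%classic x) sE.
Qed.

(** The powers of the inverse of [u ord0] have bounded representatives modulo the group generated by
    [v]. These form a finite set, so two powers share one. *)
Lemma u0_power : exists2 N, (0 < N)%N & exists c, u ord0 ^+ N = monomial v c.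
Proof.
have [s sP] := bounded_seq.
have u00 := U_neq0 (Uu ord0).
have /choice[c cP] k : exists c, forall p, `|sigma p ((u ord0)^-1 ^+ k * monomial v c)| <= D.
  apply: bounded_representative; first exact/U_exp/U_inv.
  move=> p p0; rewrite rmorphXn fmorphV normrX normfV exprn_ege1 //.
  by rewrite invf_ge1 ?place_gt0 // ltW // u_lt1.
pose f k := (u ord0)^-1 ^+ k * monomial v (c k).
have [|k [l [kl]]] := @infinite_pigeonhole _ s f.
  move=> k; apply/sP; split; last by apply: cP.
  by apply: U_mul; [apply/U_exp/U_inv|apply/U_monomial/v_in_U].
rewrite /f => fkl; exists (l - k)%N; first by rewrite subn_gt0.
exists (c l - c k); rewrite monomialD ?monomialN; try exact: v_neq0.
apply: (mulIf (monomial_neq0 v_neq0 (c k))); rewrite divfK ?(monomial_neq0 v_neq0) //.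
apply: (mulfI (expf_neq0 l (invr_neq0 u00))); rewrite -fkl mulrA; congr (_ * _).
by rewrite -{1}(subnKC (ltnW kl)) exprD -mulrA -exprMn mulVf // expr1n mulr1.
Qed.

(** The same pigeonhole argument for the powers of [x] leaves a power of [u ord0], which [u0_power]
    then absorbs. *)
Lemma U_power x : U x -> exists2 N, (0 < N)%N & exists c, x ^+ N = monomial v c.
Proof.
move=> Ux; have [s sP] := bounded_seq.
have u00 := U_neq0 (Uu ord0).
have x0 := U_neq0 Ux.
have /choice[lc lcP] k : exists lc : nat * 'rV_r, forall p,
    `|sigma p (x ^+ k * (u ord0)^-1 ^+ lc.1 * monomial v lc.2)| <= D.
  by have [l [c lcP]] := U_decomposition (U_exp k Ux); exists (l, c).
pose f k := x ^+ k * (u ord0)^-1 ^+ (lc k).1 * monomial v (lc k).2.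
have [|k [l [kl]]] := @infinite_pigeonhole _ s f.
  move=> k; apply/sP; split; last by apply: lcP.
  apply: U_mul; last exact/U_monomial/v_in_U.
  by apply: U_mul; [apply: U_exp|apply/U_exp/U_inv].
rewrite /f; case: (lc k) (lc l) => [a c] [b d] /= fkl.
have [N N0 [e eP]] := u0_power.
exists ((l - k) * N)%N; first by rewrite muln_gt0 subn_gt0 kl.
exists ((b%:Z - a%:Z) *: e + (N%:Z *: (c - d))).
have mv := monomial_neq0 v_neq0.
have ub := expf_neq0 b u00; have ua := expf_neq0 a u00.
have xlk : x ^+ (l - k) = u ord0 ^ (b%:Z - a%:Z) * monomial v (c - d).
  apply: (mulfI (expf_neq0 k x0)); rewrite -exprD subnKC ?(ltnW kl) //.
  rewrite expfzDr // -exprz_inv -!exprnP monomialD ?monomialN; try exact: v_neq0.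
  apply: (mulIf (mv d)); apply: (mulIf (expf_neq0 b (invr_neq0 u00))).
  rewrite mulrAC -fkl !exprVn.
  by move: (mv c) (mv d) => mc md; field; rewrite ub md ua.
rewrite exprM xlk exprMn [RHS]monomialD ?monomialZ; try exact: v_neq0.
by rewrite -eP !exprnP !exprz_exp [N%:Z * _]mulrC.
Qed.

Theorem unit_basis : exists k (g : 'I_k -> K) (e : 'I_r -> K),
  [/\ forall i, U (g i), forall x, U x -> exists c, x = monomial g c,
      forall j, U (e j),
      forall x, U x -> exists d m, (0 < m)%N /\ (x / monomial e d) ^+ m = 1
    & forall d m, (0 < m)%N -> monomial e d ^+ m = 1 -> d = 0].
Proof.
have [s sP] := bounded_seq.
(* By [U_decomposition] the elements bounded by [D], together with all [u p], generate [U]. *)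
pose gl := s ++ [seq u p | p : 'I_r.+1]; pose g := tnth (in_tuple gl).
have Ug i : U (g i).
  have : g i \in gl by apply: mem_tnth.
  by rewrite mem_cat => /orP[/sP[]|/mapP[p _ ->]].
have g0 i : g i != 0 by apply/U_neq0/Ug.
have gmem x : x \in gl -> exists c, x = monomial g c.
  move=> xg; have /tnthP[i ->] : x \in in_tuple gl by [].
  by exists (delta_mx 0 i); rewrite monomial_delta.
have gu p : exists c, u p = monomial g c.
  by apply: gmem; rewrite mem_cat map_f ?orbT // mem_enum.
have /fin_all_exists[b bP] (j : 'I_r) : exists b, v j = monomial g b by apply: gu.
pose B := \matrix_j b j.
have vB j : v j = monomial g (row j B) by rewrite rowK.
have /fin_all_exists2[N N0 NP] i : exists2 N, (0 < N)%N & exists a, g i ^+ N = monomial v a.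
  exact: U_power (Ug i).
(* The product of the individual exponents serves as a common one. *)
have /fin_all_exists[a aP] i : exists a, g i ^+ (\prod_j N j) = monomial v a.
  have [a aP] := NP i; exists ((\prod_(j | j != i) N j)%N%:Z *: a).
  by rewrite (bigD1 i) //= exprM aP monomialZ //; apply: v_neq0.
have [||c|i|E [Egen Efree]] := @basis_mod_torsion _ _ _ g v (\prod_j N j) (\matrix_i a i) B g0.
- by apply: prodn_gt0.
- exact: v_independent.
- by rewrite rowK.
- exact: vB.
have Ugen x : U x -> exists c, x = monomial g c.
  move=> Ux.
  have [l [c lc]] := U_decomposition Ux.
  have [c1 c1P] : exists c1, x * (u ord0)^-1 ^+ l * monomial v c = monomial g c1.
    apply: gmem; rewrite mem_cat; apply/orP; left; apply/sP; split=> //.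
    apply: U_mul; last exact/U_monomial/v_in_U.
    by apply: U_mul => //; apply/U_exp/U_inv.
  have [c0 c0P] := gu ord0.
  exists (c1 + l%:Z *: c0 - c *m B).
  rewrite !monomialD // monomialZ // monomialN // -c0P -c1P -monomial_mulmx //.
  have -> : monomial (fun j => monomial g (row j B)) c = monomial v c.
    by apply: eq_bigr => j _; rewrite vB.
  rewrite exprVn -exprnP; field.
  by rewrite (monomial_neq0 v_neq0) expf_neq0 // U_neq0.
exists (size gl), g, (fun j => monomial g (row j E)); split=> //.
- by move=> j; apply: U_monomial.
- move=> x Ux.
  have [c ->] : exists c, x = monomial g c by apply: Ugen.
  have [d dP] := Egen c; exists d, (\prod_j N j)%N.
  by rewrite dP prodn_gt0.
Qed.

End AbstractUnits.

(** * Embeddings and integrality *)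

(** This is Gauss's lemma: a rational divisor scales to a primitive integer divisor, and one of the
    two integer factors is then a unit. *)
Lemma irreducible_poly_rat (P : {poly int}) : P \is monic -> (1 < size P)%N ->
  irreducible_in P -> irreducible_poly (map_poly (intr : int -> rat) P).
Proof.
move=> Pmon Psz [P0 _ Pirr].
have szQ (q : {poly int}) : size (map_poly (intr : int -> rat) q) = size q.
  by rewrite size_map_inj_poly //; apply: intr_inj.
split; first by rewrite szQ.
move=> q q1 qP; have [q0 [a a0 qE]] := rat_poly_scale q.
have sq : size q = size q0 by rewrite qE size_scale ?invr_eq0 ?intr_eq0 // szQ.
have qq0 : q %= map_poly intr q0 by rewrite qE eqp_scale ?invr_eq0 ?intr_eq0.
have : q0 %| P by rewrite -dvdp_rat_int -(eqp_dvdl _ qq0).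
case/dvdpP_int=> s Ps; rewrite -dvdp_size_eqp // szQ sq.
have := Pirr _ _ Ps; rewrite !poly_unitE size_zprimitive -sq (negPf q1) /=.
case=> // /andP[/eqP s1 _]; apply/eqP; rewrite Ps size_mul ?s1 ?addn1 ?size_zprimitive //.
  by apply: contraNneq P0 => zq0; rewrite Ps zq0 mul0r.
by apply: contraNneq P0 => s0; rewrite Ps s0 mulr0.
Qed.

Lemma poly_rat_eval (K : fieldType) (f : {rmorphism rat -> K}) (g : {poly int}) :
  map_poly f (map_poly intr g) = map_poly intr g.
Proof. by rewrite -map_poly_comp; apply: eq_map_poly => x /=; rewrite rmorph_int. Qed.

Section Embeddings.
Variables (P : {poly int}) (K : fieldExtType rat) (lambda : K).
Let PQ : {poly rat} := map_poly intr P.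
Hypothesis Pirr : irreducible_poly PQ.
Hypothesis lambda_root : root (map_poly intr P) lambda.
Hypothesis lambda_gen : <<1; lambda>>%VS = fullv.

Let KQ := GRing.in_alg K.

(** Otherwise [f] would be coprime to the irreducible [PQ], also over [K], although both vanish at
    [lambda]. *)
Lemma dvdp_root_lambda (f : {poly rat}) : root (map_poly KQ f) lambda -> PQ %| f.
Proof.
move=> fl; apply: contraT => nPf.
have : coprimep PQ f.
  rewrite coprimep_def; apply: contraR nPf => g1.
  have := Pirr.2 (gcdp PQ f) g1 (dvdp_gcdl _ _) => /eqp_dvdl <-.
  exact: dvdp_gcdr.
rewrite -(coprimep_map KQ) => cop.
have := coprimep_root cop (x := lambda); rewrite -[_ == 0]/(root _ lambda) fl.
by rewrite /PQ poly_rat_eval => /(_ lambda_root).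
Qed.

Lemma rat_poly_generation x : exists p : {poly rat}, x = (map_poly KQ p).[lambda].
Proof. by apply/Fadjoin1_polyP; rewrite lambda_gen memvf. Qed.

Lemma rmorph_rat_horner (L : fieldType) (f : {rmorphism K -> L}) (p : {poly rat}) :
  f (map_poly KQ p).[lambda] = (map_poly ratr p).[f lambda].
Proof.
rewrite -horner_map -map_poly_comp; congr _.[_]; apply: eq_map_poly => a.
exact: (fmorph_eq_rat (f \o KQ)).
Qed.

Lemma rmorph_generator_inj (L : fieldType) (f g : {rmorphism K -> L}) :
  f lambda = g lambda -> f =1 g.
Proof. by move=> fg x; have [p ->] := rat_poly_generation x; rewrite !rmorph_rat_horner fg. Qed.

(** The embedding sends p(lambda) to p(z). This does not depend on the choice of p, because a
    polynomial vanishing at [lambda] is divisible by [PQ], hence vanishes at [z]. *)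
Lemma embedding_exists (z : algC) : root (map_poly intr P) z ->
  exists f : {rmorphism K -> algC}, f lambda = z.
Proof.
move=> Pz; have /choice[pol polE] := rat_poly_generation.
pose f x := (map_poly ratr (pol x)).[z].
have fE p x : (map_poly KQ p).[lambda] = x -> f x = (map_poly ratr p).[z].
  rewrite {1}(polE x) => /eqP; rewrite -subr_eq0 -hornerN -hornerD -rmorphN -rmorphD.
  move=> /dvdp_root_lambda/dvdpP[q].
  move=> /(congr1 (fun p => (map_poly (ratr : rat -> algC) p).[z])).
  rewrite rmorphD rmorphN rmorphM hornerD hornerN hornerM /PQ /= poly_rat_eval (rootP Pz) mulr0.
  by move=> /eqP; rewrite subr_eq0 => /eqP.
have fZ : zmod_morphism f.
  move=> x y; rewrite (fE (pol x - pol y)) ?(fE (pol x) x) ?(fE (pol y) y) //.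
    by rewrite rmorphB hornerD hornerN.
  by rewrite rmorphB hornerD hornerN -!polE.
have fM : monoid_morphism f.
  split; first by rewrite (fE 1) ?rmorph1 ?hornerC.
  move=> x y; rewrite (fE (pol x * pol y)) ?(fE (pol x) x) ?(fE (pol y) y) //.
    by rewrite rmorphM hornerM.
  by rewrite rmorphM hornerM -!polE.
pose fA := GRing.isZmodMorphism.Build K algC f fZ.
pose fR := GRing.isMonoidMorphism.Build K algC f fM.
exists (HB.pack_for {rmorphism K -> algC} f fA fR) => /=.
by rewrite (fE 'X) ?map_polyX ?hornerX.
Qed.

End Embeddings.

Lemma coef_prod_XsubC_le (R : numDomainType) (l : seq R) (B : R) k : 0 <= B ->
    {in l, forall a, `|a| <= B} ->
  `|(\prod_(a <- l) ('X - a%:P))`_k| <= (1 + B) ^+ size l.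
Proof.
move=> B0; elim: l k => [|a l IH] k lB.
  by rewrite big_nil coefC expr0; case: eqP; rewrite ?normr1 ?normr0.
have {}IH j : `|(\prod_(a <- l) ('X - a%:P))`_j| <= (1 + B) ^+ size l.
  by apply: IH => b bl; apply: lB; rewrite inE bl orbT.
have aB : `|a| <= B by apply: lB; rewrite mem_head.
rewrite big_cons mulrBl coefB coefXM coefCM exprS mulrDl mul1r.
apply: le_trans (ler_normB _ _) _; rewrite lerD //.
  case: eqP => _; last exact: IH.
  by rewrite normr0 exprn_ge0 // addr_ge0.
by rewrite normrM ler_pM.
Qed.

Lemma finite_roots (F : fieldType) (p : {poly F}) : p != 0 ->
  finite_set [set x | root p x].
Proof.
elim: {p}(size p) {-2}p (leqnn (size p)) => [|m IH] p pm p0.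
  by rewrite -size_poly_eq0 -leqn0 pm in p0.
have [[a pa]|nroot] := pselect (exists a, root p a); last first.
  rewrite (_ : [set x | _]%classic = set0) //.
  by apply/seteqP; split=> // x px; apply: nroot; exists x.
have /factor_theorem[q pq] := pa.
have q0 : q != 0 by apply: contraNneq p0 => q0; rewrite pq q0 mul0r.
apply: (@sub_finite_set _ _ ([set x | root q x] `|` [set a])%classic).
  by move=> x /=; rewrite pq rootM root_XsubC => /orP[|/eqP]; [left|right].
rewrite finite_setU; split; last exact: finite_set1.
apply: IH => //; rewrite -ltnS; apply: leq_trans pm.
by rewrite pq size_mul ?polyXsubC_eq0 // size_XsubC addn2 /=.
Qed.

Lemma finite_bounded_int_poly m N :
  finite_set [set q : {poly int} | (size q <= m)%N /\ forall k, `|q`_k| <= N%:Z].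
Proof.
(* Coefficients between -N and N are encoded by their shift by [N]. *)
pose F (f : {ffun 'I_m -> 'I_(N + N).+1}) : {poly int} :=
  \poly_(i < m) (if insub i is Some j then (f j)%:Z - N%:Z else 0).
apply: (@sub_finite_set _ _ (F @` [set: {ffun 'I_m -> 'I_(N + N).+1}])%classic); last first.
  exact/finite_image/finite_finset.
move=> q [qm qN] /=.
exists [ffun i : 'I_m => inord (absz (q`_i + N%:Z))] => //.
apply/polyP => k; rewrite coef_poly; case: ltnP => km; last first.
  by rewrite nth_default // (leq_trans qm).
rewrite insubT /= ffunE /=; have := qN k; rewrite ler_norml => /andP[l1 l2].
have n0 : 0 <= q`_k + N%:Z by rewrite -lerBlDr sub0r.
rewrite inordK ?gez0_abs ?addrK //.
by rewrite ltnS -lez_nat gez0_abs // PoszD lerD2r.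
Qed.

(** * Algebraic integers with bounded conjugates, and the norm of a unit *)

Section IntegralElements.
Variables (K : fieldExtType rat) (zs : seq algC) (z0 : algC).
Variable sigma : algC -> {rmorphism K -> algC}.
Hypothesis z0_in : z0 \in zs.
Hypothesis rat_charpoly : forall x, exists q : {poly rat},
  map_poly ratr q = \prod_(z <- zs) ('X - (sigma z x)%:P).

Lemma Aint_conjugate x z : integers K x -> sigma z x \in Aint.
Proof.
move=> [p pmon px]; apply: (@root_monic_Aint (map_poly intr p)).
- have <- : map_poly (sigma z) (map_poly intr p) = map_poly intr p.
    by rewrite -map_poly_comp; apply: eq_map_poly => a /=; rewrite rmorph_int.
  by rewrite fmorph_root.
- exact: monic_map.
- by apply/polyOverP => i; rewrite coef_map /= intr_int.
Qed.

(** The coefficients are rational and algebraic integers at the same time. *)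
Lemma int_charpoly x : integers K x -> exists q : {poly int},
  map_poly intr q = \prod_(z <- zs) ('X - (sigma z x)%:P).
Proof.
move=> xint; have [q qE] := rat_charpoly x.
suff /floorpP[p pE] : \prod_(z <- zs) ('X - (sigma z x)%:P) \is a polyOver Num.int.
  by exists p.
apply/polyOverP => i; apply: Cint_rat_Aint; first by rewrite -qE coef_map /= Crat_rat.
have /polyOverP/(_ i) // : \prod_(z <- zs) ('X - (sigma z x)%:P) \is a polyOver Aint.
by apply: rpred_prod => z _; rewrite polyOverXsubC Aint_conjugate.
Qed.

(** Bounds on the conjugates bound the coefficients of the integer polynomial of [int_charpoly];
    finitely many polynomials remain, each with finitely many roots. *)
Lemma bounded_integers_finite (B : algC) :
  finite_set [set x | integers K x /\ {in zs, forall z, `|sigma z x| <= B}].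
Proof.
have [B0|nB0] := boolP (0 <= B); last first.
  rewrite (_ : [set x | _]%classic = set0) //; apply/seteqP; split=> // x [_ xB].
  by case/negP: nB0; apply: le_trans (xB z0 z0_in); apply: normr_ge0.
pose N := Num.bound ((1 + B) ^+ size zs).
pose S := [set q : {poly int} | q != 0 /\
  ((size q <= (size zs).+1)%N /\ forall k, `|q`_k| <= N%:Z)]%classic.
apply: (@sub_finite_set _ _ (\bigcup_(q in S) [set x : K | root (map_poly intr q) x])%classic).
  move=> x [xint xB]; have [q qE] := int_charpoly xint.
  have sq : size q = (size zs).+1.
    rewrite -(size_prod_XsubC zs (fun z => sigma z x)) -qE size_map_inj_poly //.
    exact: intr_inj.
  exists q => /=.
    split; first by rewrite -size_poly_eq0 sq.
    rewrite sq; split=> // k.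
    rewrite -(ler_int algC) intr_norm -[_%:~R](coef_map (intr : {rmorphism int -> algC})) qE.
    rewrite -(big_map (fun z => sigma z x) predT (fun a => 'X - a%:P)).
    apply: le_trans (coef_prod_XsubC_le _ B0 _) _.
      by move=> _ /mapP[z zz ->]; apply: xB.
    rewrite size_map; apply/ltW/archi_boundP.
    by rewrite exprn_ge0 // addr_ge0.
  rewrite -(fmorph_root (sigma z0)) -map_poly_comp.
  have -> : map_poly (sigma z0 \o intr) q = map_poly intr q.
    by apply: eq_map_poly => a /=; rewrite rmorph_int.
  rewrite qE -(big_map (fun z => sigma z x) predT (fun a => 'X - a%:P)).
  by rewrite root_prod_XsubC; apply/mapP; exists z0.
apply: bigcup_finite.
  by apply: sub_finite_set (finite_bounded_int_poly (size zs).+1 N) => q [].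
move=> q [q0 _]; apply: finite_roots.
rewrite -(poly_rat_eval (GRing.in_alg K : {rmorphism rat -> K})) map_poly_eq0.
by rewrite -size_poly_eq0 size_map_inj_poly ?size_poly_eq0 //; apply: intr_inj.
Qed.

(** For [x] and for its inverse the product is the absolute value of a constant coefficient, so a
    natural number, and the two multiply to 1. *)
Lemma norm_unit x : x != 0 -> integers K x -> integers K x^-1 ->
  \prod_(z <- zs) `|sigma z x| = 1.
Proof.
have Nint y : integers K y -> exists a : int, \prod_(z <- zs) `|sigma z y| = `|a|%:~R.
  move=> yint; have [q qE] := int_charpoly yint; exists q`_0.
  rewrite intr_norm -[_%:~R](coef_map (intr : {rmorphism int -> algC})) qE.
  rewrite -horner_coef0 horner_prod normr_prod; apply: eq_bigr => z _.
  by rewrite !hornerE normrN.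
move=> x0 /Nint[a aE] /Nint[b bE].
have : (`|a| * `|b|)%:~R = 1 :> algC.
  rewrite intrM -aE -bE -big_split big1 //= => z _.
  by rewrite fmorphV normfV divff // normr_eq0 fmorph_eq0.
move=> /eqP; rewrite -[1]/(1%:~R) eqr_int => /eqP ab.
rewrite aE; have : (absz a * absz b = 1)%N by apply/eqP; rewrite -eqz_nat PoszM !abszE ab.
by move/eqP; rewrite muln_eq1 -abszE => /andP[/eqP->].
Qed.

End IntegralElements.

(** * The commutant of an integer matrix *)

Lemma char_poly_conj (F : fieldType) n (L A B : 'M[F]_n) :
  L \in unitmx -> L *m A = B *m L -> char_poly A = char_poly B.
Proof.
move=> Lu LA; pose LX := map_mx polyC L.
have LX0 : \det LX != 0 by rewrite det_map_mx polyC_eq0 -unitfE -unitmxE.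
apply: (mulfI LX0); rewrite /char_poly [RHS]mulrC -!det_mulmx; congr (\det _).
by rewrite /char_poly_mx mulmxBr mulmxBl -!map_mxM LA scalar_mxC.
Qed.

Lemma map_mx_exp (R S : pzRingType) (f : {rmorphism R -> S}) n (A : 'M[R]_n) k :
  map_mx f (A ^+ k) = map_mx f A ^+ k.
Proof. by elim: k => [|k IH]; rewrite ?map_mx1 // !exprS map_mxM IH. Qed.

Lemma char_poly_diag (F : fieldType) n (d : 'rV[F]_n) :
  char_poly (diag_mx d) = \prod_i ('X - (d 0 i)%:P).
Proof.
rewrite char_poly_trig ?diag_mx_is_trig //.
by apply: eq_bigr => i _; rewrite mxE eqxx.
Qed.

Lemma irreducible_poly_separable (P : {poly rat}) : irreducible_poly P -> separable_poly P.
Proof.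
move=> Pirr; rewrite unlock coprimep_def; apply: contraT => g1.
have /eqp_dvdl e := Pirr.2 _ g1 (dvdp_gcdl _ _).
have : P %| P^`() by rewrite -e dvdp_gcdr.
have P0 : P != 0 by rewrite -size_poly_gt0 (ltn_trans _ Pirr.1).
have dP : P^`() != 0.
  apply/eqP => /(congr1 (fun q : {poly rat} => q`_(size P).-2)).
  have sP : (size P).-2.+1 = (size P).-1 by case: (size P) Pirr.1 => [|[]].
  rewrite coef_deriv coef0 sP -[P`__]/(lead_coef P) => /eqP.
  by rewrite mulrn_eq0 lead_coef_eq0 (negPf P0) orbF -sP.
by move=> /(dvdp_leq dP); rewrite leqNgt lt_size_deriv.
Qed.

Lemma normalized_eigenvector (F : fieldType) n (A : 'M[F]_n) a : root (char_poly A) a ->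
  exists (v : 'rV_n) j0, v *m A = a *: v /\ v 0 j0 = 1.
Proof.
rewrite -eigenvalue_root_char => /eigenvalueP[v vA /rV0Pn[j0 vj0]].
by exists ((v 0 j0)^-1 *: v), j0; rewrite -scalemxAl vA !scalerA mulrC mxE mulVf.
Qed.

(** Among the integer vectors with entries from 0 to [B ^ m], two have nearly equal values under all
    [m] forms; their difference is the required vector. *)
Lemma thue_siegel (R : archiNumFieldType) m n (ell : 'I_m -> 'I_n -> R) (c B : nat) :
    (0 < n)%N -> (0 < B)%N -> (forall s k, ell s k \is Num.real) ->
    (forall s, \sum_k `|ell s k| < c%:R) ->
  exists a : 'I_n -> int, [/\ exists k, a k != 0,
    forall k, `|a k| <= (B ^ m)%N%:Z
    & forall s, `|\sum_k (a k)%:~R * ell s k| * B%:R ^+ n <= (2 * c)%:R * B%:R ^+ m].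
Proof.
move=> n0 B0 ellr ellc; pose A := (B ^ m)%N.
pose T := {ffun 'I_n -> 'I_A.+1}.
pose val (f : T) s : R := \sum_k (f k : nat)%:R * ell s k.
have A0 : 0 < A%:R :> R by rewrite ltr0n expn_gt0 B0.
have c0 (s : 'I_m) : 0 < c%:R :> R.
  by apply: le_lt_trans (ellc s); rewrite sumr_ge0.
have valr f s : val f s \is Num.real.
  by apply: sum_real => k _; apply: realM; rewrite ?realn ?ellr.
have valb f s : `|val f s| < c%:R * A%:R.
  apply: le_lt_trans (_ : (\sum_k `|ell s k|) * A%:R < _); last by rewrite ltr_pM2r.
  apply: le_trans (ler_norm_sum _ _ _) _; rewrite mulr_suml ler_sum // => k _.
  by rewrite normrM mulrC ler_wpM2l // normr_nat ler_nat -ltnS.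
have D0 (s : 'I_m) : 0 < (2 * c)%:R * A%:R :> R.
  by rewrite natrM; apply: mulr_gt0 => //; apply: mulr_gt0 (ltr0Sn _ _) (c0 s).
(* The range of the values, from -cA to cA, is rescaled to the range from 0 to [B ^ n], and the
   floor then names one of [B ^ n] boxes. *)
pose y f s : R := (val f s + c%:R * A%:R) * (B%:R ^+ n / ((2 * c)%:R * A%:R)).
have yr f s : y f s \is Num.real.
  apply: realM; first by apply: realD; rewrite ?valr // realM ?realn.
  by rewrite realM ?realV ?realM ?realX ?realn.
have Bn0 : 0 < B%:R ^+ n :> R by rewrite exprn_gt0 // ltr0n.
have y0 f s : 0 <= y f s.
  have := valb f s; rewrite real_ltr_norml // => /andP[l _].
  by rewrite mulr_ge0 ?divr_ge0 ?(ltW (D0 s)) ?(ltW Bn0) // -lerBlDr sub0r ltW.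
have yB f s : y f s < (B ^ n)%N%:R.
  have := valb f s; rewrite real_ltr_norml // => /andP[_ l].
  rewrite /y mulrCA natrX gtr_pMr // ltr_pdivrMr ?(D0 s) // mul1r natrM mulrDl.
  by rewrite mulrDl mul1r ltrD2r.
have y_floor f s : (absz (Num.floor (y f s)) < B ^ n)%N.
  have f0 : 0 <= Num.floor (y f s) by rewrite real_floor_ge0.
  rewrite -ltz_nat gez0_abs // -(ltr_int R).
  exact: le_lt_trans (real_floor_le (yr f s)) (yB f s).
pose idx (f : T) : {ffun 'I_m -> 'I_(B ^ n)} := [ffun s => Ordinal (y_floor f s)].
(* There are (B^m + 1)^n vectors, but only (B^n)^m combinations of boxes. *)
have /injectivePn[f [g fg idxfg]] : ~~ injectiveb idx.
  apply/injectiveP => /leq_card; rewrite !card_ffun !card_ord leqNgt => /negP; apply.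
  by rewrite -expnM mulnC expnM ltn_exp2r.
exists (fun k => (f k : nat)%:Z - (g k : nat)%:Z); split.
- have [k fgk] : exists k, f k != g k.
    apply: contrapT => fgE; case/eqP: fg; apply/ffunP => k; apply: contrapT => /eqP fgk.
    by apply: fgE; exists k.
  by exists k; rewrite subr_eq0.
- move=> k; have := ltn_ord (f k); have := ltn_ord (g k).
  by rewrite -/A; lia.
move=> s.
have floorE : Num.floor (y f s) = Num.floor (y g s).
  have := congr1 (fun h : {ffun 'I_m -> 'I_(B ^ n)} => (h s : nat)) idxfg; rewrite !ffunE /= => e.
  have f0 h : 0 <= Num.floor (y h s) by rewrite real_floor_ge0.
  by rewrite -(gez0_abs (f0 f)) -(gez0_abs (f0 g)) e.
have y1 : `|y f s - y g s| < 1.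
  have := real_floor_itv (yr f s); have := real_floor_itv (yr g s).
  rewrite floorE rmorphD /= => /andP[l1 l2] /andP[l3 l4].
  rewrite real_ltr_norml ?realB // ltrBlDr ltrNl opprB ltrBlDr ![1 + _]addrC.
  by rewrite (lt_le_trans l2) ?(lt_le_trans l4) ?lerD2r.
have <- : val f s - val g s = \sum_k ((f k)%:Z - (g k)%:Z)%:~R * ell s k.
  by rewrite -sumrB; apply: eq_bigr => k _; rewrite rmorphB /= mulrBl.
move: y1; rewrite /y -mulrBl opprD addrACA subrr addr0 normrM [X in _ * X]ger0_norm; last first.
  by apply: divr_ge0; apply: ltW; rewrite ?(D0 s).
by rewrite mulrA ltr_pdivrMr ?(D0 s) // mul1r /A natrX => /ltW.
Qed.

(** As [\det Y] divides [Q], the matrix Q Y^-1 is integral, hence so is X Y^-1 = 1 + W (Q Y^-1). By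
    symmetry Y X^-1 is integral too. *)
Lemma unitmx_quotient n (Q : int) (X Y W : 'M[int]_n) :
    X = Y + Q *: W -> \det X != 0 -> \det Y != 0 ->
    (\det X %| Q)%Z -> (\det Y %| Q)%Z ->
  exists2 G, G \in unitmx & G *m Y = X.
Proof.
move=> XY X0 Y0 /dvdzP[q Qq] /dvdzP[t Qt].
have GY : (1%:M + W *m (t *: \adj Y)) *m Y = X.
  rewrite mulmxDl mul1mx -mulmxA -scalemxAl mul_adj_mx XY Qt; congr (_ + _).
  by rewrite scale_scalar_mx mul_mx_scalar.
have GX : (1%:M - W *m (q *: \adj X)) *m X = Y.
  rewrite mulmxBl mul1mx -mulmxA -scalemxAl mul_adj_mx scale_scalar_mx mul_mx_scalar.
  by rewrite -Qq {1}XY addrK.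
exists (1%:M + W *m (t *: \adj Y)) => //.
set G := (1%:M + _) in GY *; set H := (1%:M - _) in GX.
have HG : (H *m G - 1%:M) *m Y = 0 by rewrite mulmxBl mul1mx -mulmxA GY GX subrr.
suff /mulmx1_unit[] : H *m G = 1%:M by [].
apply/row_matrixP => i; apply/eqP; rewrite -subr_eq0 -linearB; apply/eqP.
by apply: (int_mulmx_eq0 Y0); rewrite -row_mul HG row0.
Qed.

Lemma prod_le_exp (R : numDomainType) (I : eqType) (l : seq I) (F : I -> R) (b : R) :
  {in l, forall i, 0 <= F i <= b} -> \prod_(i <- l) F i <= b ^+ size l.
Proof.
elim: l => [|i l IH] Fb; first by rewrite big_nil.
have /andP[F0 F1] := Fb i (mem_head _ _).
have Fl : {in l, forall j, 0 <= F j <= b} by move=> j jl; apply: Fb; rewrite inE jl orbT.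
rewrite big_cons exprS ler_pM ?IH //.
by rewrite big_seq; apply: prodr_ge0 => j /Fl/andP[].
Qed.

(** * The eigenvector, its conjugates, and units from the lattice Z[lambda] *)

Section Eigenvector.
Variables (n : nat) (A : 'M[int]_n) (K : fieldExtType rat) (lambda : K).
Let PQ : {poly rat} := map_poly intr (char_poly A).
Hypothesis Pirr : irreducible_poly PQ.
Hypothesis lambda_root : root (map_poly intr (char_poly A)) lambda.
Hypothesis lambda_gen : <<1; lambda>>%VS = fullv.
Variable zs : seq algC.
Hypothesis zsE : map_poly intr (char_poly A) = \prod_(z <- zs) ('X - z%:P).
Variable sigma : algC -> {rmorphism K -> algC}.
Hypothesis sigmaE : {in zs, forall z, sigma z lambda = z}.
Hypothesis zs_conj : {in zs, forall z, z^* \in zs}.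
Variables (v : 'rV[K]_n) (j0 : 'I_n).
Hypothesis vA : v *m map_mx intr A = lambda *: v.
Hypothesis vj0 : v 0 j0 = 1.

Let KQ := GRing.in_alg K.

Lemma size_roots : size zs = n.
Proof.
have := size_prod_XsubC zs id; rewrite -zsE size_map_inj_poly ?size_char_poly //.
  by case.
exact: intr_inj.
Qed.

Lemma uniq_roots_zs : uniq zs.
Proof.
rewrite -separable_prod_XsubC -zsE -(poly_rat_eval (ratr : {rmorphism rat -> algC})).
by rewrite separable_map irreducible_poly_separable.
Qed.

Let zi (i : 'I_n) := zs`_i.

Lemma root_in i : zi i \in zs.
Proof. by rewrite mem_nth // size_roots. Qed.

(** This matrix diagonalises simultaneously all rational matrices that have [v] as an eigenvector
    over [K]. *)
Definition conjugates : 'M[algC]_n := \matrix_(i, j) sigma (zi i) (v 0 j).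

Lemma conjugates_diag (G : 'M[rat]_n) x : v *m map_mx KQ G = x *: v ->
  conjugates *m map_mx ratr G = diag_mx (\row_i sigma (zi i) x) *m conjugates.
Proof.
move=> vG; apply/matrixP => i j; rewrite mul_diag_mx !mxE.
have /(congr1 (sigma (zi i))) : (v *m map_mx KQ G) 0 j = (x *: v) 0 j by rewrite vG.
rewrite !mxE rmorphM rmorph_sum => <-; apply: eq_bigr => k _.
by rewrite !mxE rmorphM; congr (_ * _); rewrite -(fmorph_eq_rat (sigma (zi i) \o KQ)).
Qed.

Lemma eigenvector_exp (d : 'rV[K]_n) k : d *m map_mx intr A = lambda *: d ->
  d *m map_mx intr (A ^+ k) = lambda ^+ k *: d.
Proof.
move=> dA; elim: k => [|k IH]; first by rewrite !expr0 scale1r map_mx1 mulmx1.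
by rewrite exprSr map_mxM mulmxA IH -scalemxAl dA scalerA exprSr.
Qed.

(* The columns are the Krylov basis e, A e, A^2 e, ... of the vector e with
   v e = 1, so that its conjugates form a Vandermonde matrix. *)
Definition krylov : 'M[int]_n := \matrix_(i, k) (A ^+ k) i j0.

Lemma krylov_eigenvector (d : 'rV[K]_n) k : d *m map_mx intr A = lambda *: d ->
  (d *m map_mx intr krylov) 0 k = lambda ^+ k * d 0 j0.
Proof.
move=> /(eigenvector_exp k)/(congr1 (fun u : 'rV_n => u 0 j0)).
by rewrite !mxE => <-; apply: eq_bigr => i _; rewrite !mxE.
Qed.

(** The product is a Vandermonde determinant at distinct roots. Its first factor makes [conjugates]
    invertible, its second makes the eigenspace of [lambda] a line. *)
Lemma det_conjugates_krylov : \det conjugates * (\det krylov)%:~R != 0.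
Proof.
have LE : conjugates *m map_mx intr krylov = (Vandermonde n (\row_i zi i))^T.
  apply/matrixP => i k; rewrite !mxE.
  have := krylov_eigenvector k vA; rewrite vj0 mulr1 => /(congr1 (sigma (zi i))).
  rewrite rmorphXn /= sigmaE ?root_in // => <-; rewrite mxE rmorph_sum.
  by apply: eq_bigr => l _; rewrite !mxE rmorphM rmorph_int.
rewrite -[_%:~R](det_map_mx (intr : {rmorphism int -> algC})) -det_mulmx LE det_tr.
rewrite det_Vandermonde; apply/prodf_neq0 => i _; apply/prodf_neq0 => j ij.
rewrite !mxE subr_eq0 /zi nth_uniq ?size_roots // ?uniq_roots_zs //.
by rewrite gtn_eqF.
Qed.

Lemma conjugates_unit : conjugates \in unitmx.
Proof.
have := det_conjugates_krylov.
by rewrite mulf_eq0 negb_or unitmxE unitfE => /andP[].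
Qed.

(** On the Krylov columns an eigenvector is determined by its entry at [j0], and these columns are
    independent. *)
Lemma eigenvector_unique (d : 'rV[K]_n) : d *m map_mx intr A = lambda *: d ->
  d = d 0 j0 *: v.
Proof.
move=> dA; apply/eqP; rewrite -subr_eq0; apply/eqP; set d' := d - _.
have d'A : d' *m map_mx intr A = lambda *: d'.
  by rewrite mulmxBl dA -scalemxAl vA scalerBr !scalerA mulrC.
have d'E : d' *m map_mx intr krylov = 0.
  apply/rowP => k; rewrite krylov_eigenvector // !mxE vj0 mulr1 subrr.
  by rewrite mulr0.
have := congr1 (mulmx^~ (map_mx intr (\adj krylov))) d'E.
rewrite /= mul0mx -mulmxA -map_mxM mul_mx_adj map_scalar_mx mul_mx_scalar => /eqP.
rewrite scalemx_eq0 => /orP[|/eqP->//].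
rewrite -[X in X == 0](rmorph_int (GRing.in_alg K : {rmorphism rat -> K})).
rewrite fmorph_eq0 intr_eq0 => /eqP E0.
by have := det_conjugates_krylov; rewrite E0 mulr0 eqxx.
Qed.

Lemma commutant_eigenvector (G : 'M[int]_n) : G *m A = A *m G ->
  v *m map_mx intr G = (v *m map_mx intr G) 0 j0 *: v.
Proof.
move=> GA; apply: eigenvector_unique.
by rewrite -mulmxA -map_mxM GA map_mxM mulmxA vA -scalemxAl.
Qed.

Lemma in_alg_map_intr m (B : 'M[int]_m) :
  map_mx KQ (map_mx intr B) = map_mx intr B.
Proof.
apply/matrixP => i j; rewrite !mxE.
exact: (rmorph_int (GRing.in_alg K : {rmorphism rat -> K})).
Qed.

(** Being rational, [G] is annihilated by all conjugates of [v] as well, and these form an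
    invertible matrix. *)
Lemma eigenvector_inj (G : 'M[int]_n) : v *m map_mx intr G = 0 -> G = 0.
Proof.
move=> vG; pose GQ : 'M[rat]_n := map_mx intr G.
have /conjugates_diag : v *m map_mx KQ GQ = 0 *: v.
  by rewrite in_alg_map_intr vG scale0r.
rewrite (_ : \row_i sigma (zi i) 0 = 0); last by apply/rowP => i; rewrite !mxE rmorph0.
rewrite linear0 mul0mx => /(congr1 (mulmx (invmx conjugates))).
rewrite mulKmx ?conjugates_unit // mulmx0 => G0; apply/matrixP => i j.
have := congr1 (fun B : 'M[algC]_n => B i j) G0; rewrite !mxE => /eqP.
by rewrite fmorph_eq0 intr_eq0 => /eqP.
Qed.

Lemma char_poly_conjugates (G : 'M[rat]_n) x : v *m map_mx KQ G = x *: v ->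
  map_poly ratr (char_poly G) = \prod_(y <- zs) ('X - (sigma y x)%:P).
Proof.
move=> /conjugates_diag LG; rewrite map_char_poly.
rewrite (char_poly_conj conjugates_unit LG) char_poly_diag (big_nth 0) size_roots big_mkord.
by apply: eq_bigr => i _; rewrite mxE.
Qed.

(** The polynomial expressing [x] in [lambda] is evaluated at [A]. With [char_poly_conjugates] this
    gives a rational polynomial whose roots are the conjugates of [x]. *)
Lemma matrix_of_element x : exists G : 'M[rat]_n, v *m map_mx KQ G = x *: v.
Proof.
have [p ->] := rat_poly_generation lambda_gen x.
have vAQ k : v *m map_mx KQ (map_mx intr A ^+ k) = lambda ^+ k *: v.
  by rewrite -(eigenvector_exp k vA) -(in_alg_map_intr (A ^+ k)) !map_mx_exp.
exists (\sum_(k < size p) p`_k *: map_mx intr A ^+ k).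
pose f : {rmorphism rat -> K} := GRing.in_alg K.
rewrite (map_mx_sum f) mulmx_sumr horner_coef size_map_poly scaler_suml.
apply: eq_bigr => k _.
by rewrite (map_mxZ f) -scalemxAr vAQ scalerA coef_map.
Qed.

Implicit Type a : 'I_n -> int.

(** The same coordinates [a] describe an element of Z[lambda] and, through [lattice_matrix], the
    matrix in Z[A] with that eigenvalue at [v]. *)
Definition lattice_element a : K := \sum_k (a k)%:~R * lambda ^+ k.
Definition lattice_matrix a : 'M[int]_n := \sum_k a k *: A ^+ k.

Lemma lattice_matrix_eigenvector a :
  v *m map_mx intr (lattice_matrix a) = lattice_element a *: v.
Proof.
rewrite map_mx_sum mulmx_sumr scaler_suml; apply: eq_bigr => k _.
by rewrite map_mxZ -scalemxAr (eigenvector_exp k vA) scalerA.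
Qed.

Lemma lattice_matrix_comm a : lattice_matrix a *m A = A *m lattice_matrix a.
Proof.
rewrite mulmx_suml mulmx_sumr; apply: eq_bigr => k _.
by rewrite -scalemxAl -scalemxAr -[_ *m _]/(A ^+ k * A) -exprSr exprS.
Qed.

Lemma det_conjugates (G : 'M[int]_n) x : v *m map_mx intr G = x *: v ->
  `|\det G|%:~R = \prod_(z <- zs) `|sigma z x|.
Proof.
rewrite -in_alg_map_intr => /char_poly_conjugates PG.
rewrite intr_norm -[_%:~R](ratr_int algC).
have -> : (\det G)%:~R = (-1) ^+ n * (char_poly (map_mx intr G : 'M[rat]_n))`_0.
  by rewrite char_poly_det mulrA -expr2 sqrr_sign mul1r det_map_mx.
rewrite rmorphM normrM rmorphXn rmorphN1 normrX normrN1 expr1n mul1r.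
rewrite -(coef_map (ratr : {rmorphism rat -> algC})) PG -horner_coef0 horner_prod normr_prod.
by apply: eq_bigr => z _; rewrite hornerXsubC sub0r normrN.
Qed.

(** A nonzero polynomial of degree less than [n] cannot vanish at [lambda]. *)
Lemma lattice_element_neq0 a k : a k != 0 -> lattice_element a != 0.
Proof.
move=> ak; apply/eqP => a0.
pose p : {poly rat} := \poly_(i < n) (if insub i is Some j then (a j)%:~R else 0).
have pi (i : 'I_n) : p`_i = (a i)%:~R.
  by rewrite coef_poly ltn_ord insubT // => h; rewrite (_ : Sub _ _ = i) //; apply: val_inj.
have p0 : p != 0.
  by apply: contraNneq ak => p0; have := pi k; rewrite p0 coef0 => /esym/eqP; rewrite intr_eq0.
suff /(dvdp_root_lambda Pirr lambda_root)/(dvdp_leq p0) : root (map_poly (GRing.in_alg K) p) lambda.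
  rewrite size_map_inj_poly // ?size_char_poly; last exact: intr_inj.
  by rewrite leqNgt ltnS size_poly.
apply/rootP; rewrite -[RHS]a0 (@horner_coef_wide _ n) ?size_map_poly ?size_poly //.
by apply: eq_bigr => i _; rewrite coef_map /= pi -[_%:A]/(GRing.in_alg K _) rmorph_int.
Qed.

Lemma conjugate_lattice_element z a : z \in zs ->
  sigma z (lattice_element a) = \sum_k (a k)%:~R * z ^+ k.
Proof.
move=> zzs; rewrite rmorph_sum; apply: eq_bigr => k _.
by rewrite rmorphM rmorph_int rmorphXn /= sigmaE.
Qed.

Variable z0 : algC.
(** A place is a real root or a conjugate pair; what remains are the roots away from the place of
    [z0]. *)
Let others := [seq z <- zs | (z != z0) && (z != z0^*)].
Hypothesis z0_in : z0 \in zs.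

Lemma others_conj z : z \in others -> z^* \in others.
Proof.
rewrite !mem_filter => /andP[/andP[h1 h2] /zs_conj ->]; rewrite andbT.
by rewrite (can2_eq conjCK conjCK) h2 (inj_eq (can_inj conjCK)).
Qed.

Lemma size_others : (size others < n)%N.
Proof.
rewrite -size_roots size_filter -(count_predC (fun z => (z != z0) && (z != z0^*)) zs).
rewrite -[X in (X < _)%N]addn0 ltn_add2l -has_count.
by apply/hasP; exists z0 => //=; rewrite eqxx.
Qed.

(* The linear forms [w s + (w s)^*], with [s] the conjugate at [z] and
   [w = 1 + 'i], are real; those at [z] and [z^*] together determine [s]. *)
Lemma small_elements : exists C : nat, forall B : nat, (0 < B)%N -> exists a,
  [/\ exists k, a k != 0,
      {in others, forall z, `|sigma z (lattice_element a)| * B%:R <= C%:R}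
    & \prod_(z <- zs) `|sigma z (lattice_element a)| <= C%:R].
Proof.
set m := size others; pose w : algC := 1 + 'i.
(* A coefficient of a form is at most twice the absolute value of [w] times the power of the root,
   whence the 4. Summing over all roots gives one [c] for all forms. *)
pose S : algC := \sum_(z <- zs) \sum_(k < n) 4%:R * `|z| ^+ k.
have S0 : 0 <= S.
  rewrite sumr_ge0 // => z _; rewrite sumr_ge0 // => k _.
  by rewrite mulr_ge0 ?exprn_ge0.
pose c := Num.bound S.
have Sc : S < c%:R by apply: archi_boundP.
have Sz z : z \in zs -> \sum_(k < n) 4%:R * `|z| ^+ k < c%:R.
  move=> zzs; apply: le_lt_trans Sc; rewrite /S (big_rem z) //= lerDl.
  by rewrite sumr_ge0 // => y _; rewrite sumr_ge0 // => k _; rewrite mulr_ge0 ?exprn_ge0.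
pose ell (s : 'I_m) (k : 'I_n) : algC := w * others`_s ^+ k + (w * others`_s ^+ k)^*.
have w2 : `|w| <= 2%:R by apply: le_trans (ler_normD _ _) _; rewrite normr1 normCi.
have others_zs z : z \in others -> z \in zs by rewrite mem_filter => /andP[].
have oth (s : 'I_m) : others`_s \in others by rewrite mem_nth.
(* The first summand serves the bound at [others], the second the bound on the norm. *)
exists (4 * c + (4 * c) ^ n)%N => B B0.
have [|s|s|a [ak aB aell]] := @thue_siegel algC m n ell c B _ B0.
- exact: leq_ltn_trans (leq0n j0) (ltn_ord j0).
- by move=> k; rewrite CrealE rmorphD /= conjCK addrC.
- apply: le_lt_trans (Sz _ (others_zs _ (oth s))); apply: ler_sum => k _.
  apply: le_trans (ler_normD _ _) _; rewrite norm_conjC -mulr2n (natrM _ 2 2).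
  by rewrite -mulrA -[X in X <= _]mulr_natl ler_wpM2l // normrM normrX ler_wpM2r // exprn_ge0.
pose x z := sigma z (lattice_element a).
have c0 : (0 < c)%N by rewrite -(ltr0n algC); apply: le_lt_trans Sc.
have Bp : 0 < B%:R :> algC by rewrite ltr0n.
have big z : z \in zs -> `|x z| <= (4 * c)%:R * B%:R ^+ m.
  move=> zzs; rewrite /x conjugate_lattice_element //.
  apply: le_trans (ler_norm_sum _ _ _) _.
  apply: le_trans (_ : \sum_(k < n) 4%:R * `|z| ^+ k * B%:R ^+ m <= _).
    apply: ler_sum => k _; rewrite normrM normrX mulrC ler_pM ?exprn_ge0 //.
      by rewrite ler_peMl ?exprn_ge0 // ler1n.
    by rewrite -intr_norm -natrX -[_%:R]/((B ^ m)%N%:Z%:~R) ler_int.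
  rewrite -mulr_suml ler_wpM2r ?exprn_ge0 ?(ltW Bp) //.
  by apply: le_trans (ltW (Sz z zzs)) _; rewrite ler_nat leq_pmull.
have form z : z \in others -> `|w * x z + (w * x z)^*| * B%:R ^+ n <= (2 * c)%:R * B%:R ^+ m.
  move=> zo; have sz : (index z others < m)%N by rewrite index_mem.
  have := aell (Ordinal sz); rewrite (_ : \sum_k _ = w * x z + (w * x z)^*) //.
  rewrite /x conjugate_lattice_element ?others_zs // mulr_sumr rmorph_sum -big_split.
  apply: eq_bigr => k _; rewrite /ell nth_index //= mulrDr; congr (_ + _); first by rewrite mulrCA.
  by rewrite mulrCA !rmorphM rmorph_int.
have small z : z \in others -> `|x z| * B%:R ^+ n <= (4 * c)%:R * B%:R ^+ m.
  move=> zo; have zzs := others_zs z zo.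
  have xc : x z^* = (x z)^*.
    rewrite /x !conjugate_lattice_element ?zs_conj // rmorph_sum; apply: eq_bigr => k _.
    by rewrite rmorphM rmorph_int rmorphXn.
  have f1 := form z zo; have := form _ (others_conj zo); rewrite xc => f2.
  have wc : w^* = 1 - 'i by rewrite rmorphD /= rmorph1 conjCi.
  (* The terms with the conjugate of [x z] cancel, and [w ^+ 2 - w^* ^+ 2] is [4%:R * 'i]. *)
  have e : 4%:R * 'i * x z = w * (w * x z + (w * x z)^*) - w^* * (w * (x z)^* + (w * (x z)^*)^*).
    rewrite !rmorphM /= conjCK; transitivity ((w ^+ 2 - w^* ^+ 2) * x z); last by ring.
    by rewrite wc /w; ring.
  have : `|4%:R * 'i * x z| * B%:R ^+ n <= 4%:R * ((4 * c)%:R * B%:R ^+ m).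
    rewrite e; apply: le_trans (_ : (`|w| * `|w * x z + (w * x z)^*| +
      `|w| * `|w * (x z)^* + (w * (x z)^*)^*|) * B%:R ^+ n <= _).
      by rewrite ler_wpM2r ?exprn_ge0 ?(ltW Bp) // (le_trans (ler_normB _ _)) // !normrM norm_conjC.
    rewrite mulrDl -!mulrA.
    apply: le_trans (_ : 2%:R * ((2 * c)%:R * B%:R ^+ m) + 2%:R * ((2 * c)%:R * B%:R ^+ m) <= _).
      by rewrite lerD // ler_pM // mulr_ge0 ?exprn_ge0 ?(ltW Bp).
    rewrite -!natrX -!natrM -natrD ler_nat; lia.
  by rewrite !normrM normCi mulr1 normr_nat -mulrA ler_pM2l // ltr0n.
have mn := size_others; rewrite -/m in mn.
exists a; split=> // [z zo|].
  (* As [m < n], the power [B ^+ n] contains [B ^+ m.+1]; cancelling [B ^+ m] leaves the factor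
     [B]. *)
  have := small z zo; rewrite -(subnKC mn) exprD exprSr.
  rewrite !mulrA => h.
  apply: le_trans (_ : (4 * c)%:R <= _); last by rewrite ler_nat leq_addr.
  rewrite -(ler_pM2r (exprn_gt0 m Bp)); apply: le_trans h.
  rewrite mulrAC ler_peMr ?mulr_ge0 ?exprn_ge0 ?(ltW Bp) //.
  by rewrite exprn_ege1 // ler1n.
pose nP z := (z != z0) && (z != z0^*).
rewrite (bigID nP) /= -big_filter -[X in _ * X]big_filter.
set far := [seq z <- zs | ~~ nP z].
have sfar : (size far + m = n)%N.
  by rewrite addnC /m !size_filter -size_roots; apply: (count_predC nP zs).
have p1 : \prod_(z <- others) `|x z| <= ((4 * c)%:R * B%:R ^+ m / B%:R ^+ n) ^+ m.
  apply: prod_le_exp => z zo; rewrite normr_ge0 ler_pdivlMr ?exprn_gt0 //.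
  exact: small.
have p2 : \prod_(z <- far) `|x z| <= ((4 * c)%:R * B%:R ^+ m) ^+ size far.
  by apply: prod_le_exp => z; rewrite mem_filter normr_ge0 => /andP[_ /big].
apply: le_trans (_ : ((4 * c)%:R ^+ n <= _)); last by rewrite -natrX ler_nat leq_addl.
apply: le_trans (ler_pM _ _ p1 p2) _; try by apply: prodr_ge0.
(* All powers of [B] cancel because [size far + m = n], so the bound on the norm does not depend on
   [B]. *)
rewrite le_eqVlt; apply/orP; left; apply/eqP.
rewrite expr_div_n mulrAC -exprD addnC sfar exprMn -!exprM [(n * m)%N]mulnC mulfK //.
by rewrite expf_neq0 // gt_eqF.
Qed.

(** Lattice elements of bounded norm are produced that decrease strictly at [others]. Two of them
    agree modulo a common multiple of their determinants, and their quotient is the unit. *)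
Lemma unit_at_place : exists (G : 'M[int]_n) x,
  [/\ G \in unitmx, G *m A = A *m G, v *m map_mx intr G = x *: v
    & {in others, forall z, `|sigma z x| < 1}].
Proof.
have [C smallC] := small_elements.
pose good a := lattice_element a != 0 /\ \prod_(z <- zs) `|sigma z (lattice_element a)| <= C%:R.
have good_next a : exists b, good a -> good b /\
    {in others, forall z, `|sigma z (lattice_element b)| < `|sigma z (lattice_element a)|}.
  have [ga|nga] := pselect (good a); last by exists a.
  have x0 z : 0 < `|sigma z (lattice_element a)| by rewrite normr_gt0 fmorph_eq0 ga.1.
  pose F z := C%:R / `|sigma z (lattice_element a)|.
  have F0 z : 0 <= F z by rewrite divr_ge0.
  (* For this [B], the quotient of [C] by [B.+1] is below every value of the current element at
     [others]. *)
  pose B := Num.bound (\sum_(z <- others) F z).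
  have FB z : z \in others -> F z < B%:R.
    move=> zo; apply: le_lt_trans (archi_boundP _); last by rewrite sumr_ge0.
    by rewrite (big_rem z) //= lerDl sumr_ge0.
  have [b [[k bk] bC bN]] := smallC B.+1 isT.
  exists b => _; split; first by split; first exact: lattice_element_neq0 bk.
  move=> z zo; have := FB z zo; rewrite ltr_pdivrMr // => h.
  have B0 : 0 < B.+1%:R :> algC by rewrite ltr0Sn.
  rewrite -(ltr_pM2r B0); apply: le_lt_trans (bC z zo) _; apply: lt_le_trans h _.
  by rewrite mulrC ler_wpM2l // ler_nat.
have [next nextP] := choice good_next.
have [a0 [[k0 a0k] _ a0N]] := smallC 1%N isT.
have good0 : good a0 by split; first exact: lattice_element_neq0 a0k.
pose f k := iter k next a0.
have goodf k : good (f k) by elim: k => //= k /nextP[].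
have dec k l : (k < l)%N ->
    {in others, forall z, `|sigma z (lattice_element (f l))| < `|sigma z (lattice_element (f k))|}.
  move=> + z zo; elim: l => // l IH; rewrite ltnS leq_eqVlt => /predU1P[->|/IH].
    exact: (nextP _ (goodf l)).2.
  by apply: lt_trans; apply: (nextP _ (goodf l)).2.
(* All determinants involved are nonzero integers of absolute value at most [C], so they divide
   [Q]. *)
pose Q := C`!; have Q0 : (0 < Q)%N by apply: fact_gt0.
have Qz : Q%:Z != 0 by rewrite -[_ == 0]/(Q == 0%N) -lt0n.
pose color k : {ffun 'I_n -> 'I_Q.+1} := [ffun i => inord (absz (f k i %% Q%:Z)%Z)].
have [|k [l [kl]]] := @infinite_pigeonhole _ (enum {: {ffun 'I_n -> 'I_Q.+1}}) color.
  by move=> k; rewrite mem_enum.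
move=> colkl.
have modkl i : (f k i = f l i %[mod Q%:Z])%Z.
  have := congr1 (fun h : {ffun 'I_n -> 'I_Q.+1} => (h i : nat)) colkl; rewrite !ffunE.
  have lt j : (absz (f j i %% Q%:Z)%Z < Q.+1)%N.
    by rewrite ltnS ltnW // -ltz_nat gez0_abs ?modz_ge0 // ltz_pmod.
  rewrite !inordK // => e.
  by rewrite -[LHS]gez0_abs ?modz_ge0 // e gez0_abs ?modz_ge0.
pose c i := ((f l i - f k i) %/ Q%:Z)%Z.
have fl i : f l i = f k i + Q%:Z * c i.
  rewrite mulrC divzK ?subrKC //.
  by rewrite -eqz_mod_dvd; apply/eqP.
have XY : lattice_matrix (f l) = lattice_matrix (f k) + Q%:Z *: lattice_matrix c.
  rewrite /lattice_matrix scaler_sumr -big_split; apply: eq_bigr => i _.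
  by rewrite fl scalerDl scalerA.
have detf j : \det (lattice_matrix (f j)) != 0 /\ (\det (lattice_matrix (f j)) %| Q%:Z)%Z.
  have := det_conjugates (lattice_matrix_eigenvector (f j)); have [f0 fN] := goodf j.
  move=> e; rewrite -e in fN.
  have d0 : \det (lattice_matrix (f j)) != 0.
    rewrite -normr_eq0 -(intr_eq0 algC) e; rewrite prodf_seq_neq0.
    by apply/allP => z _; rewrite /= normr_eq0 fmorph_eq0.
  split=> //; apply: dvdn_fact; rewrite absz_gt0 d0 -lez_nat abszE -(ler_int algC).
  exact: fN.
have [G Gu GY] := unitmx_quotient XY (detf l).1 (detf k).1 (detf l).2 (detf k).2.
(* Multiplied by [lattice_matrix (f k)], whose determinant is nonzero, the commutator of [G] and [A]
   vanishes, as both lattice matrices commute with [A]. *)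
have GA : G *m A = A *m G.
  apply/row_matrixP => i; apply/eqP; rewrite -subr_eq0 -linearB; apply/eqP.
  apply: (int_mulmx_eq0 (detf k).1); rewrite -row_mul mulmxBl.
  rewrite -mulmxA -lattice_matrix_comm !mulmxA GY lattice_matrix_comm -GY -!mulmxA.
  by rewrite subrr row0.
have vG := commutant_eigenvector GA.
set x := (v *m map_mx intr G) 0 j0 in vG.
exists G, x; split=> // z zo.
have xE : x * lattice_element (f k) = lattice_element (f l).
  have := congr1 (fun u : 'rV_n => u 0 j0) (lattice_matrix_eigenvector (f l)).
  rewrite /= -GY map_mxM mulmxA vG -scalemxAl lattice_matrix_eigenvector scalerA.
  by rewrite !mxE vj0 !mulr1.
have fk0 : 0 < `|sigma z (lattice_element (f k))| by rewrite normr_gt0 fmorph_eq0 (goodf k).1.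
by rewrite -(ltr_pM2r fk0) mul1r -normrM -rmorphM xE; apply: dec.
Qed.

End Eigenvector.

(** * Ranks and isomorphisms *)

(** The Smith form has a zero last row, so the last row of [invmx L] lies in the left kernel. *)
Lemma int_left_kernel r (D : 'M[int]_(r.+1, r)) :
  exists2 c : 'rV_r.+1, c != 0 & c *m D = 0.
Proof.
have [L Lu [R _ [d _ ->]]] := int_Smith_normal_form D.
exists (row ord_max (invmx L)).
  apply: contraTneq isT => L0; have := congr1 (mulmx^~ L) L0.
  rewrite /= mul0mx -row_mul mulVmx // => /rowP/(_ ord_max).
  by rewrite !mxE eqxx.
rewrite -mulmxA -row_mul mulKmx // row_mul (_ : row _ _ = 0) ?mul0mx //.
by apply/rowP => j; rewrite !mxE gtn_eqF.
Qed.

Section UnitsValues.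
Variable K : fieldExtType rat.
Implicit Types u : units K.

Lemma units_neq0 u : unitsval u != 0.
Proof. by rewrite -unitfE; apply: (valP u). Qed.

Lemma units_of_neq0 (x : K) : x != 0 -> exists u, unitsval u = x.
Proof. by rewrite -unitfE => xu; exists (MkUnits xu). Qed.

Lemma unitsvalX u k : unitsval (u ^+ k)%g = unitsval u ^+ k.
Proof. by elim: k => // k IH; rewrite expgS exprS -IH. Qed.

Lemma unitsval_expgz u z : unitsval (expgz u z) = unitsval u ^ z.
Proof.
case: z => k /=; first by rewrite unitsvalX.
by rewrite -[LHS]/((unitsval (u ^+ k.+1)%g)^-1) unitsvalX.
Qed.

Lemma unitsval_prod k (e : 'I_k -> units K) (c : 'I_k -> int) :
  unitsval (\prod_i expgz (e i) (c i))%g = monomial (fun i => unitsval (e i)) (\row_i c i).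
Proof.
rewrite /monomial (big_morph (@unitsval K) (id1 := 1) (op1 := *%R)) //.
by apply: eq_bigr => i _; rewrite unitsval_expgz mxE.
Qed.

Variables (U : set (units K)) (r : nat).
Hypothesis U_group : is_subgroup U.
Hypothesis U_basis : exists k (g : 'I_k -> K) (e : 'I_r -> K),
  [/\ forall i, (@unitsval K @` U)%classic (g i),
      forall x, (@unitsval K @` U)%classic x -> exists c, x = monomial g c,
      forall j, (@unitsval K @` U)%classic (e j),
      forall x, (@unitsval K @` U)%classic x ->
        exists d m, (0 < m)%N /\ (x / monomial e d) ^+ m = 1
    & forall d m, (0 < m)%N -> monomial e d ^+ m = 1 -> d = 0].

Lemma subgroup_mul x y : U x -> U y -> U (x * y)%g.
Proof.
move=> Ux Uy; have Uy' : U (y^-1)%g.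
  by rewrite -[(y^-1)%g]mul1g; apply: U_group.2 => //; exact: U_group.1.
by rewrite -[y]invgK; apply: U_group.2.
Qed.

Lemma subgroup_expgz x z : U x -> U (expgz x z).
Proof.
have UX k y : U y -> U (y ^+ k)%g.
  move=> Uy; elim: k => [|k IH]; first exact: U_group.1.
  by rewrite expgS; apply: subgroup_mul.
case: z => k Ux /=; first exact: UX.
by rewrite -[(x ^- _)%g]mul1g; apply: U_group.2; [exact: U_group.1 | exact: UX].
Qed.

Lemma subgroup_prod k (e : 'I_k -> units K) (c : 'I_k -> int) : (forall i, U (e i)) ->
  U (\prod_i expgz (e i) (c i))%g.
Proof.
move=> Ue; elim/big_ind: _ => [|x y|i _]; [exact: U_group.1 | exact: subgroup_mul |].
exact: subgroup_expgz.
Qed.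

Lemma has_rank_of_basis : has_rank U r.
Proof.
have [k [g [e [Ug gen Ue tors free]]]] := U_basis.
have /fin_all_exists[g' g'P] i : exists u, U u /\ unitsval u = g i.
  by have [u Uu <-] := Ug i; exists u.
have /fin_all_exists[e' e'P] j : exists u, U u /\ unitsval u = e j.
  by have [u Uu <-] := Ue j; exists u.
have e0 j : e j != 0 by rewrite -(e'P j).2 units_neq0.
split.
- exists k, g'; split=> [i|x Ux]; first exact: (g'P i).1.
  have [c xc] := gen (unitsval x) (imageP _ Ux).
  exists (fun i => c 0 i); apply: val_inj; rewrite /= unitsval_prod xc.
  by apply: eq_bigr => i _; rewrite (g'P i).2 mxE.
- exists e' => [j|c]; first exact: (e'P j).1.
  move=> /(congr1 (@unitsval K)); rewrite unitsval_prod => c1 i.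
  have /rowP/(_ i) : \row_i c i = 0.
    apply: (free _ 1%N) => //; rewrite expr1 -[RHS]c1.
    by apply: eq_bigr => j _; rewrite (e'P j).2.
  by rewrite !mxE.
- move=> f Uf ind; have f0 i : unitsval (f i) != 0 := units_neq0 _.
  have /fin_all_exists[d dP] i : exists d, exists m,
      (0 < m)%N /\ (unitsval (f i) / monomial e d) ^+ m = 1.
    exact: tors (imageP _ (Uf i)).
  have /fin_all_exists[m mP] := dP.
  (* The relation [c] between the coordinate vectors holds for the [f i] only up to torsion, which
     the exponent [N] below removes. *)
  have [c c0 cd] := int_left_kernel (\matrix_i d i).
  pose N := (\prod_i m i)%N; have N0 : (0 < N)%N by apply: prodn_gt0 => i; apply: (mP i).1.
  case/eqP: c0; apply/rowP => i; rewrite mxE.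
  suff /ind/(_ i)/eqP : (\prod_i expgz (f i) (N%:Z * c 0 i))%g = 1%g.
    by rewrite mulf_eq0 -[N%:Z == 0]/(N == 0%N) gtn_eqF //= => /eqP.
  apply: val_inj; rewrite /= unitsval_prod.
  have -> : \row_i (N%:Z * c 0 i) = N%:Z *: c by apply/rowP => j; rewrite !mxE.
  rewrite monomialZ // -exprnP.
  have -> : monomial (fun i => unitsval (f i)) c =
      \prod_i (unitsval (f i) / monomial e (d i)) ^ c 0 i.
    transitivity (monomial (fun i => unitsval (f i)) c /
        monomial (fun i => monomial e (row i (\matrix_i d i))) c).
      by rewrite monomial_mulmx // cd monomial0 invr1 mulr1.
    rewrite {1 2}/monomial -prodfV -big_split; apply: eq_bigr => j _ /=.
    by rewrite rowK expfzMl exprz_inv invr_expz.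
  rewrite -prodrXl big1 // => j _.
  rewrite exprnP exprzAC -exprnP /N (bigD1 j) //= exprM (mP j).2 expr1n exp1rz //.
Qed.

Let T := [set u | U u /\ exists2 k, (0 < k)%N & (u ^+ k)%g = 1%g]%classic.

Lemma torsion_subgroup : is_subgroup T.
Proof.
split; first by split; [exact: U_group.1 | exists 1%N].
move=> x y [Ux [k k0 xk]] [Uy [l l0 yl]]; split; first exact: U_group.2.
exists (k * l)%N; first by rewrite muln_gt0 k0.
apply: val_inj; rewrite /= unitsvalX.
rewrite -[unitsval (x / y)%g]/(unitsval x / unitsval y) exprMn exprVn.
rewrite exprM mulnC exprM -!unitsvalX xk yl !unitsvalX.
by rewrite -[unitsval 1%g]/(1 : K) !expr1n invr1 mulr1.
Qed.

(** An element [u] goes to its torsion part [u / mon (d u)] together with its coordinate vector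
    [d u] modulo torsion. *)
Lemma isomorphic_of_basis :
  isomorphic U (T `*` [set: GRing.to_multiplicative 'rV[int]_r])%classic.
Proof.
have [k [g [e [Ug gen Ue tors free]]]] := U_basis.
have /fin_all_exists[e' e'P] j : exists u, U u /\ unitsval u = e j.
  by have [u Uu <-] := Ue j; exists u.
have e0 j : e j != 0 by rewrite -(e'P j).2 units_neq0.
pose mon (d : 'rV[int]_r) := (\prod_i expgz (e' i) (d 0 i))%g.
have monE d : unitsval (mon d) = monomial e d.
  rewrite unitsval_prod; apply: eq_bigr => j _; rewrite (e'P j).2; congr (_ ^ _).
  by rewrite mxE.
have Umon d : U (mon d) by apply: subgroup_prod => j; apply: (e'P j).1.
have monD c d : mon (c + d) = (mon c * mon d)%g.
  by apply: val_inj; rewrite /= monE monomialD // -!monE.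
have /choice[d dP] (u : units K) : exists d : 'rV[int]_r, U u -> T (u / mon d)%g.
  have [Uu|nUu] := pselect (U u); last by exists 0.
  have [d [m [m0 dm]]] := tors _ (imageP _ Uu); exists d => _.
  split; first exact: U_group.2.
  by exists m => //; apply: val_inj; rewrite /= unitsvalX -dm -monE.
(* Two coordinate vectors of [u] differ by one whose monomial is torsion, hence by 0. Additivity of
   [d] follows from this uniqueness. *)
have d_uniq u c : U u -> T (u / mon c)%g -> d u = c.
  move=> Uu Tc; apply/eqP; rewrite -subr_eq0; apply/eqP.
  have [_ [m m0 mP]] := torsion_subgroup.2 _ _ Tc (dP u Uu).
  apply: (free _ m m0); have := congr1 (@unitsval K) mP.
  rewrite unitsvalX => mE; rewrite -[RHS]mE; congr (_ ^+ _).
  rewrite monomialD // monomialN // -!monE.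
  rewrite -[RHS]/((unitsval u / unitsval (mon c)) / (unitsval u / unitsval (mon (d u)))).
  by field; rewrite !units_neq0.
have dM x y : U x -> U y -> d (x * y)%g = d x + d y.
  move=> Ux Uy; apply: d_uniq; first exact: subgroup_mul.
  have <- : ((x / mon (d x)) / ((y / mon (d y))^-1))%g = (x * y / mon (d x + d y))%g.
    apply: val_inj; rewrite /= monD.
    rewrite -[LHS]/((unitsval x / unitsval (mon (d x))) / (unitsval y / unitsval (mon (d y)))^-1).
    rewrite -[RHS]/(unitsval x * unitsval y / (unitsval (mon (d x)) * unitsval (mon (d y)))).
    by field; rewrite !units_neq0.
  apply: torsion_subgroup.2; first exact: dP.
  rewrite -[(_^-1)%g]mul1g; apply: torsion_subgroup.2; last exact: dP.
  exact: torsion_subgroup.1.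
exists (fun u => ((u / mon (d u))%g, d u)).
  split.
  - by move=> u Uu; split=> //=; apply: dP.
  - move=> x y _ _ e1; have dxy : d x = d y := congr1 snd e1.
    have := congr1 (fun t => t.1 * mon (d y))%g e1; rewrite /= dxy.
    by rewrite !divgK.
  - move=> [t c] [/= Tt _]; have dt : d (t * mon c)%g = c.
      apply: d_uniq; first by apply: subgroup_mul => //; case: Tt.
      by rewrite mulgK.
    by exists (t * mon c)%g; [apply: subgroup_mul => //; case: Tt | rewrite dt mulgK].
move=> x y Ux Uy; rewrite dM //; congr (_, _).
apply: val_inj; rewrite /= monD.
rewrite -[LHS]/(unitsval x * unitsval y / (unitsval (mon (d x)) * unitsval (mon (d y)))).
rewrite -[RHS]/((unitsval x / unitsval (mon (d x))) * (unitsval y / unitsval (mon (d y)))).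
by field; rewrite !units_neq0.
Qed.

End UnitsValues.

Lemma isomorphic_trans (F G H : groupType) (A : set F) (B : set G) (C : set H) :
  isomorphic A B -> isomorphic B C -> isomorphic A C.
Proof.
move=> [f fbij fM] [g gbij gM]; exists (g \o f); first exact: set_bij_comp gbij.
move=> x y Ax Ay /=; rewrite fM // gM //; exact: set_bij_homo fbij _ _.
Qed.

Lemma unit_group_subgroup (K : fieldExtType rat) : is_subgroup (unit_group K).
Proof.
split.
  split; rewrite /integers /= ?invr1;
  exact: (integral1 (intr : {rmorphism int -> K})).
move=> x y [xi xVi] [yi yVi]; split;
  last rewrite -[unitsval (x / y)%g]/(unitsval x / unitsval y) invfM invrK.
  exact: (integral_mul (RtoK := (intr : {rmorphism int -> K}))).
exact: (integral_mul (RtoK := (intr : {rmorphism int -> K}))).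
Qed.

(** * From the roots of the polynomial to the places of K *)

Section Places.
Variables (K : fieldExtType rat) (rs cs : seq algC) (r : nat).
Let zs := rs ++ cs ++ [seq z^* | z <- cs].
Hypothesis zs_uniq : uniq zs.
Hypothesis rs_real : {in rs, forall z, z \is Num.real}.
Hypothesis cs_nreal : {in cs, forall z, z \isn't Num.real}.
Hypothesis size_places : size (rs ++ cs) = r.+1.
Variable sigma : algC -> {rmorphism K -> algC}.
Hypothesis sigma_conj : {in zs, forall z x, sigma z^* x = (sigma z x)^*}.

Let place (p : 'I_r.+1) := (rs ++ cs)`_p.
(** The weight 2 at a non-real root accounts for the conjugate root, which has the same absolute
    value. *)
Let w p := if place p \is Num.real then 1%N else 2.

Lemma place_in p : place p \in zs.
Proof. by rewrite /zs catA mem_cat mem_nth // size_places. Qed.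

Lemma zs_conj_closed : {in zs, forall z, z^* \in zs}.
Proof.
move=> z; rewrite !mem_cat => /or3P[zr|zc|/mapP[y yc ->]].
- by rewrite (CrealP (rs_real zr)) zr.
- by rewrite map_f ?orbT.
- by rewrite conjCK yc orbT.
Qed.

Lemma prod_places x :
  \prod_p `|sigma (place p) x| ^+ w p = \prod_(z <- zs) `|sigma z x|.
Proof.
pose F z : algC := `|sigma z x| ^+ (if z \is Num.real then 1%N else 2).
transitivity (\prod_(z <- rs ++ cs) F z); first by rewrite [RHS](big_nth 0) size_places big_mkord.
rewrite /zs !big_cat /= big_map; congr (_ * _).
  by apply: eq_big_seq => z zr; rewrite /F rs_real.
rewrite -big_split; apply: eq_big_seq => z zc /=.
rewrite /F (negPf (cs_nreal zc)) sigma_conj ?norm_conjC ?expr2 //.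
by rewrite !mem_cat zc orbT.
Qed.

Lemma bounded_places (B : algC) x : (forall p, `|sigma (place p) x| <= B) ->
  {in zs, forall z, `|sigma z x| <= B}.
Proof.
move=> xB z; rewrite /zs catA mem_cat.
have h y : y \in rs ++ cs -> `|sigma y x| <= B.
  move=> yp; have yr : (index y (rs ++ cs) < r.+1)%N by rewrite -size_places index_mem.
  by have := xB (Ordinal yr); rewrite /place /= nth_index.
move=> /orP[/h//|/mapP[y yc ->]].
by rewrite sigma_conj ?norm_conjC ?h // !mem_cat yc ?orbT.
Qed.

(** This puts every place other than [p] among the roots at which the unit built for [p] is
    small. *)
Lemma distinct_places p q : q != p -> (place q != place p) && (place q != (place p)^*).
Proof.
move=> qp; have := zs_uniq; rewrite /zs catA cat_uniq => /and3P[un disj _].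
have pq : place q != place p by rewrite nth_uniq ?size_places.
rewrite pq /=; have pin : place p \in rs ++ cs by rewrite mem_nth ?size_places.
move: (pin); rewrite mem_cat => /orP[/rs_real/CrealP->//|pc].
apply: contraNneq disj => qpc; apply/hasP; exists (place q).
  by rewrite qpc map_f.
by rewrite /= mem_nth ?size_places.
Qed.

Variable U : set (units K).
Hypothesis U_group : is_subgroup U.
Hypothesis U_sub : (U `<=` unit_group K)%classic.
Hypothesis rat_charpoly : forall x : K, exists q : {poly rat},
  map_poly ratr q = \prod_(z <- zs) ('X - (sigma z x)%:P).
Variable u : 'I_r.+1 -> units K.
Hypothesis Uu : forall p, U (u p).
Hypothesis u_lt1 : forall p q, q != p -> `|sigma (place q) (unitsval (u p))| < 1.

(** The subgroup [U] is arbitrary, so that the image of S(M) and the full unit group are treated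
    alike. *)
Lemma subgroup_rank_structure : has_rank U r /\
  isomorphic U ([set x | U x /\ exists2 k, (0 < k)%N & (x ^+ k)%g = 1%g] `*`
                [set: GRing.to_multiplicative 'rV[int]_r])%classic.
Proof.
pose U' := (@unitsval K @` U)%classic.
have [||||||||k [g [e basis]]] := @unit_basis K r (fun p => sigma (place p)) w U'
    (fun p => unitsval (u p)).
- by move=> p; rewrite /w; case: ifP.
- by exists 1%g => //; apply: U_group.1.
- by move=> _ _ [x Ux <-] [y Uy <-]; exists (x / y)%g => //; apply: U_group.2.
- by move=> _ [x _ <-]; apply: units_neq0.
- move=> _ [x /U_sub[xi xVi] <-].
  by rewrite prod_places (norm_unit rat_charpoly) ?units_neq0.
- move=> B; have := bounded_integers_finite (place_in ord0) rat_charpoly B.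
  apply: sub_finite_set => _ [[x /U_sub[xi _] <-] xB]; split=> //.
  exact: bounded_places.
- by move=> p; exists (u p).
- exact: u_lt1.
by split; [apply: has_rank_of_basis | apply: isomorphic_of_basis] => //; exists k, g, e.
Qed.

End Places.

(** * The embedding of S(M) into the units of K *)

Section Commutant.
Variables (n : nat) (M : GLZ n) (K : fieldExtType rat) (lambda : K).
Let A : 'M[int]_n := GLZval M.
Variables (v : 'rV[K]_n) (j0 : 'I_n).
Hypothesis vA : v *m map_mx intr A = lambda *: v.
Hypothesis vj0 : v 0 j0 = 1.
Hypothesis commutant : forall G : 'M[int]_n, G *m A = A *m G ->
  v *m map_mx intr G = (v *m map_mx intr G) 0 j0 *: v.
Hypothesis v_inj : forall G : 'M[int]_n, v *m map_mx intr G = 0 -> G = 0.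

Let S := symmetry_group M.
Let phi (G : GLZ n) : K := (v *m map_mx intr (GLZval G)) 0 j0.

Lemma symmetry_commute G : S G <-> GLZval G *m A = A *m GLZval G.
Proof.
split; first by move=> /(congr1 (@GLZval n)).
by move=> h; apply: val_inj.
Qed.

Lemma eigenvalue_symmetry G : S G -> v *m map_mx intr (GLZval G) = phi G *: v.
Proof. by move=> /symmetry_commute/commutant. Qed.

Lemma symmetry_div G H : S G -> S H -> S (G / H)%g.
Proof.
rewrite /S /symmetry_group /= => SG SH.
have SHV : (M * H^-1 = H^-1 * M)%g.
  by apply: (mulgI H); rewrite mulgA -SH mulgK mulgA mulgV mul1g.
by rewrite mulgA SG -!mulgA SHV.
Qed.

Lemma eigenvalue_symmetryM G H : S G -> S H -> phi (G * H)%g = phi G * phi H.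
Proof.
move=> SG SH; rewrite {1}/phi -[GLZval (G * H)%g]/(GLZval G *m GLZval H).
rewrite map_mxM mulmxA eigenvalue_symmetry // -scalemxAl eigenvalue_symmetry //.
by rewrite scalerA mxE vj0 mulr1.
Qed.

Lemma eigenvalue_symmetry1 : phi 1%g = 1.
Proof. by rewrite /phi map_mx1 mulmx1. Qed.

Lemma symmetry1 : S 1%g.
Proof. by rewrite /S /symmetry_group /= mulg1 mul1g. Qed.

Lemma symmetryV G : S G -> S (G^-1)%g.
Proof. by move=> SG; rewrite -[(G^-1)%g]mul1g; apply: symmetry_div => //; apply: symmetry1. Qed.

Lemma eigenvalue_symmetryV G : S G -> phi G * phi (G^-1)%g = 1.
Proof.
move=> SG; rewrite -eigenvalue_symmetryM ?mulgV ?eigenvalue_symmetry1 //.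
exact: symmetryV.
Qed.

Lemma eigenvalue_symmetry_integer G : S G -> integers K (phi G).
Proof.
move=> SG; exists (char_poly (GLZval G)); first exact: char_poly_monic.
rewrite map_char_poly -eigenvalue_root_char; apply/eigenvalueP.
exists v; first exact: eigenvalue_symmetry.
by apply: contraTneq isT => v0; move: vj0; rewrite v0 mxE => /esym/eqP; rewrite oner_eq0.
Qed.

(** The eigenvalue at [v] determines [G] by [v_inj]. It is a root of the characteristic polynomial
    of [G], and so is its inverse for [G^-1], which makes it a unit of the ring of integers. *)
Lemma symmetry_embedding : exists2 f : GLZ n -> units K,
    forall G, S G -> unitsval (f G) = phi G &
  let H := (f @` S)%classic in
  [/\ is_subgroup H, (H `<=` unit_group K)%classic & isomorphic S H].
Proof.
have /choice[f fP] G : exists x : units K, S G -> unitsval x = phi G.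
  have [SG|] := pselect (S G); last by exists 1%g.
  have /units_of_neq0[x xE] : phi G != 0.
    apply: contraTneq isT => G0; have := eigenvalue_symmetryV SG.
    by rewrite G0 mul0r => /esym/eqP; rewrite oner_eq0.
  by exists x.
have fM G H : S G -> S H -> f (G * H)%g = (f G * f H)%g.
  move=> SG SH; apply: val_inj; rewrite /= fP.
    by rewrite eigenvalue_symmetryM // -!fP.
  by rewrite -[H]invgK; apply: symmetry_div => //; apply: symmetryV.
exists f => // H; split.
- split.
    exists 1%g; first exact: symmetry1.
    by apply: val_inj; rewrite /= fP ?eigenvalue_symmetry1 //; exact: symmetry1.
  move=> _ _ [G SG <-] [G' SG' <-]; exists (G / G')%g; first exact: symmetry_div.
  by apply: (mulIg (f G')); rewrite -fM ?divgK //; apply: symmetry_div.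
- move=> _ [G SG <-]; split; rewrite fP //; first exact: eigenvalue_symmetry_integer.
  have Gn0 : phi G != 0 by rewrite -fP ?units_neq0.
  have -> : (phi G)^-1 = phi (G^-1)%g.
    by apply: (mulfI Gn0); rewrite divff // eigenvalue_symmetryV.
  exact/eigenvalue_symmetry_integer/symmetryV.
- exists f; last exact: fM.
  split; first by move=> G SG; exists G.
    move=> G G' /set_mem SG /set_mem SG' fGG'; apply: val_inj; apply/eqP.
    rewrite -subr_eq0; apply/eqP/v_inj.
    rewrite map_mxB mulmxBr !eigenvalue_symmetry //.
    by rewrite -!fP // fGG' subrr.
  by move=> _ [G SG <-]; exists G.
Qed.

End Commutant.

(** * Comparison of S(M) with the unit group of the maximal order *)

Theorem proposition1 (n : nat) (hn : (2 <= n)%N) (M : GLZ n)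
  (P : {poly int}) (hP : P = char_poly M) (hirr : irreducible_in P)
  (n1 n2 : nat) (hsig : has_signature P n1 n2)
  (K : fieldExtType rat) (lambda : K)
  (hroot : root (map_poly intr P) lambda)
  (hK : <<1; lambda>>%VS = fullv) :
  (exists H : set (units K),
     [/\ is_subgroup H, (H `<=` unit_group K)%classic,
         isomorphic (symmetry_group M) H
       & maximal_rank H (unit_group K)])
  /\
  (exists T' : set (units K),
     [/\ is_subgroup T', (T' `<=` roots_of_unity K)%classic
       & isomorphic (symmetry_group M)
           (T' `*` [set: GRing.to_multiplicative 'rV[int]_(n1 + n2 - 1)])%classic]).
Proof.
subst P; pose A : 'M[int]_n := GLZval M.
have Pmon : char_poly A \is monic by apply: char_poly_monic.
have Pirr : irreducible_poly (map_poly (intr : int -> rat) (char_poly A)).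
  by apply: irreducible_poly_rat; rewrite ?size_char_poly // ltnS ltnW.
have [rs [cs [srs scs rsr csr zsE]]] := hsig.
set zs := rs ++ cs ++ _ in zsE.
rewrite (monicP Pmon) scale1r in zsE.
have uz : uniq zs := uniq_roots_zs Pirr zsE.
have szs : size zs = n := size_roots zsE.
(* There is at least one place as [n] is positive, so the truncated subtraction is exact. *)
have rpos : (n1 + n2 - 1).+1 = (n1 + n2)%N.
  by move: szs; rewrite !size_cat size_map srs scs; lia.
have [v [j0 [vA vj0]]] : exists (v : 'rV[K]_n) j0,
    v *m map_mx intr A = lambda *: v /\ v 0 j0 = 1.
  by apply: normalized_eigenvector; rewrite -map_char_poly.
have root_zs z : z \in zs -> root (map_poly intr (char_poly A)) z.
  by move=> zzs; rewrite zsE root_prod_XsubC.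
have zs0 : zs`_0 \in zs by rewrite mem_nth // szs; apply: leq_trans hn.
(* Outside [zs] the embedding at the first root serves as a default value. *)
have /choice[sigma sigmaE] z : exists f : {rmorphism K -> algC}, z \in zs -> f lambda = z.
  have [zzs|nz] := boolP (z \in zs).
    by have [f fl] := embedding_exists Pirr hroot hK (root_zs z zzs); exists f.
  by have [f _] := embedding_exists Pirr hroot hK (root_zs _ zs0); exists f.
have zs_conj : {in zs, forall z, z^* \in zs} by apply: zs_conj_closed.
have sigma_conj : {in zs, forall z x, sigma z^* x = (sigma z x)^*}.
  move=> z zzs; apply: (rmorph_generator_inj hK (f := sigma z^*) (g := Num.conj \o sigma z)).
  by rewrite /= !sigmaE ?zs_conj.
have rat_charpoly x : exists q : {poly rat},
    map_poly ratr q = \prod_(z <- zs) ('X - (sigma z x)%:P).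
  have [G vG] := matrix_of_element hK vA x.
  by exists (char_poly G); apply: (char_poly_conjugates Pirr zsE sigmaE vA vj0 vG).
have comm G := commutant_eigenvector Pirr zsE sigmaE vA vj0 (G := G).
have inj G := eigenvector_inj Pirr zsE sigmaE vA vj0 (G := G).
have [f fP [Hgrp HE isoSH]] := symmetry_embedding vj0 comm inj.
set H := (f @` _)%classic in Hgrp HE isoSH.
have szp : size (rs ++ cs) = (n1 + n2 - 1).+1 by rewrite size_cat srs scs rpos.
have /fin_all_exists[u uP] (p : 'I_(n1 + n2 - 1).+1) : exists u, H u /\
    forall q, q != p -> `|sigma (rs ++ cs)`_q (unitsval u)| < 1.
  have pz : (rs ++ cs)`_p \in zs by rewrite /zs catA mem_cat mem_nth // szp.
  have [G [x [Gu GA vG xlt]]] :=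
    unit_at_place Pirr hroot zsE sigmaE zs_conj vA vj0 pz.
  pose GG := MkGLZ Gu; have SG : symmetry_group M GG by apply: val_inj; rewrite /= GA.
  exists (f GG); split; first by exists GG.
  move=> q qp; rewrite fP // vG mxE vj0 mulr1; apply: xlt.
  by rewrite mem_filter distinct_places // /zs catA mem_cat mem_nth // szp.
have Hu p : H (u p) := (uP p).1.
have ult p q := (uP p).2 q.
have [rankH isoH] := subgroup_rank_structure rsr csr szp sigma_conj Hgrp HE rat_charpoly Hu ult.
(* The units found in the image of S(M) also belong to the full unit group and serve there
   unchanged; hence the ranks agree. *)
have [rankE _] := subgroup_rank_structure rsr csr szp sigma_conj
  (unit_group_subgroup K) (fun x h => h) rat_charpoly (fun p => HE _ (Hu p)) ult.
split; first by exists H; split=> //; exists (n1 + n2 - 1)%N.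
(* The group [T'] is the torsion of [H]. *)
eexists; split; last exact: isomorphic_trans isoSH isoH.
  exact: torsion_subgroup.
by move=> x [/HE[xi _] xk].
Qed.
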